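(* Let $X=C(\overline\Omega)$ and assume there is $a_2\in(0,\hat a)$ such that $\beta\equiv0$ on $[a_2,\hat a)\times\overline\Omega$ and $\int_a^{a_2}\underline\beta(l)dl>0$ for every $a\in[0,a_2)$. Assume $\mathcal A$ possesses a principal eigenvalue $\lambda_1(\mathcal A)$ with an eigenvector $(0,\phi)$, $\phi\in W^{1,1}((0,a_2),C(\overline\Omega))$, $\phi>0$. Then $\mathcal A$ admits the strong maximum principle if and only if $\lambda_1(\mathcal A)<0$.
   Context: Setting. $N\ge1$, $\Omega\subset\mathbb R^N$ bounded domain, $\hat a\in(0,\infty]$, $D>0$. $J\in C(\mathbb R^N)$ nonnegative, supported in some ball $B(0,r)$, $J(0)>0$, $\int J=1$. $\beta\in C(\mathbb R^N,L^\infty_+(0,\hat a))$, $\mu\in C(\mathbb R^N,L^\infty_{\mathrm{loc},+}[0,\hat a))$ with $\mu\ge\tilde\mu>0$ a.e.; $\underline\beta(a)=\min_{x\in\overline\Omega}\beta(a,x)$. $K\varphi=\int_\Omega J(\cdot-y)\varphi(y)dy$. The operator $\mathcal A$ acts on $C(\overline\Omega)\times L^1((0,a_2),C(\overline\Omega))$ with domain $\{0\}\times W^{1,1}((0,a_2),C(\overline\Omega))$, $\mathcal A(0,\phi)=\big(-\phi(0)+\int_0^{a_2}\beta(a,\cdot)\phi(a)da,\ -\partial_a\phi+D(K\phi-\phi)-\mu(a,\cdot)\phi\big)$. A principal eigenvalue is a real eigenvalue with a positive eigenvector, larger than the real part of every other eigenvalue. Inequalities such as $\mathcal A(0,u)\le(0,0)$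 are componentwise and pointwise. Strong maximum principle: $\mathcal A$ admits it if for every $u\in W^{1,1}((0,a_2),C(\overline\Omega))$ with $\mathcal A(0,u)\le(0,0)$ in $[0,a_2]\times\Omega$, either $u\equiv0$ in $[0,a_2]\times\Omega$ or $u>0$ in $[0,a_2]\times\Omega$. *)

(* Defs.v *)
From HB Require Import structures.
From mathcomp Require Import all_boot all_order all_algebra.
From mathcomp Require Import all_classical all_reals all_analysis.
Set Implicit Arguments. Unset Strict Implicit. Unset Printing Implicit Defensive.
Import Order.TTheory GRing.Theory Num.Theory.
Import numFieldNormedType.Exports.
Local Open Scope classical_set_scope.
Local Open Scope ring_scope.

Section Defs.
Variable R : realType.

Local Notation leb := (@lebesgue_measure R).

Definition rint (A : set R) (f : R -> R) : R :=
  fine (\int[leb]_(t in A) (f t)%:E)%E.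

(* Integral over R^N written as the iterated one-dimensional Lebesgue
   integral (Fubini); used only for bounded, compactly supported,
   measurable integrands. *)
Fixpoint iint (n : nat) : ('rV[R]_n -> R) -> R :=
  match n return ('rV[R]_n -> R) -> R with
  | 0 => fun f => f 0
  | n'.+1 => fun f =>
      rint setT (fun t => iint (fun v : 'rV[R]_n' =>
                   f (row_mx (const_mx t : 'rV[R]_1) v)))
  end.

Definition open_interval (a b : R) : set R := [set t | a < t < b].
Definition closed_interval (a b : R) : set R := [set t | a <= t <= b].

Definition bounded_domain N (Om : set 'rV[R]_N) : Prop :=
  open Om /\ connected Om /\ Om !=set0 /\
  exists M : R, forall x, Om x -> `|x| <= M.

Definition Kop N (J : 'rV[R]_N -> R) (Om : set 'rV[R]_N)
  (f : 'rV[R]_N -> R) (x : 'rV[R]_N) : R :=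
  iint (fun y => (\1_Om y : R) * J (x - y) * f y).

Definition kernel_hyp N (J : 'rV[R]_N -> R) : Prop :=
  continuous J /\ (forall y, 0 <= J y) /\
  (exists r : R, 0 < r /\ forall y, r <= `|y| -> J y = 0) /\
  0 < J 0 /\ iint J = 1.

(* beta in C(R^N, L^infty_+(0,ahat)) *)
Definition beta_hyp N (ahat : \bar R) (beta : R -> 'rV[R]_N -> R) : Prop :=
  let I := [set a : R | 0 < a /\ (a%:E < ahat)%E] in
  (forall x, measurable_fun I (fun a => beta a x)) /\
  (forall x, exists M : R, {ae leb, forall a, I a -> `|beta a x| <= M}) /\
  (forall x, {ae leb, forall a, I a -> 0 <= beta a x}) /\
  (forall x (e : R), 0 < e -> exists d : R, 0 < d /\ forall y, `|y - x| < d ->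
     {ae leb, forall a, I a -> `|beta a y - beta a x| <= e}).

(* mu in C(R^N, L^infty_{loc,+}[0,ahat)), mu >= mut > 0 a.e. *)
Definition mu_hyp N (ahat : \bar R) (mu : R -> 'rV[R]_N -> R) (mut : R) : Prop :=
  let I := [set a : R | 0 < a /\ (a%:E < ahat)%E] in
  (forall x, measurable_fun I (fun a => mu a x)) /\
  (forall x (b : R), 0 < b -> (b%:E < ahat)%E ->
     exists M : R, {ae leb, forall a, 0 < a < b -> `|mu a x| <= M}) /\
  (forall (b : R), 0 < b -> (b%:E < ahat)%E -> forall x (e : R), 0 < e ->
     exists d : R, 0 < d /\ forall y, `|y - x| < d ->
     {ae leb, forall a, 0 < a < b -> `|mu a y - mu a x| <= e}) /\
  0 < mut /\ (forall x, {ae leb, forall a, I a -> mut <= mu a x}).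

Definition beta_low N (Om : set 'rV[R]_N) (beta : R -> 'rV[R]_N -> R) (a : R)
  : \bar R := ereal_inf [set (beta a x)%:E | x in closure Om].

Definition strongly_measurable N (Om : set 'rV[R]_N) (a2 : R)
  (g : R -> 'rV[R]_N -> R) : Prop :=
  exists (k : nat -> nat) (A : nat -> nat -> set R)
         (c : nat -> nat -> 'rV[R]_N -> R),
    (forall n i, measurable (A n i)) /\
    (forall n i, {within closure Om, continuous (c n i)}) /\
    {ae leb, forall a, open_interval 0 a2 a ->
       forall e : R, 0 < e -> exists n0, forall n, (n0 <= n)%N ->
       forall x, closure Om x ->
       `|\sum_(i < k n) (\1_(A n i) a : R) * c n i x - g a x| <= e}.

Definition L1C N (Om : set 'rV[R]_N) (a2 : R) (g : R -> 'rV[R]_N -> R) : Prop :=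
  strongly_measurable Om a2 g /\
  (\int[leb]_(a in open_interval 0 a2)
     ereal_sup [set (`|g a x|)%:E | x in closure Om] < +oo)%E.

(* u in W^{1,1}((0,a2), C(closure Om)), u being its continuous
   representative on [0,a2] and g its derivative d_a u *)
Definition W11 N (Om : set 'rV[R]_N) (a2 : R) (u g : R -> 'rV[R]_N -> R)
  : Prop :=
  (forall a, closed_interval 0 a2 a -> {within closure Om, continuous (u a)}) /\
  L1C Om a2 g /\
  (forall a, closed_interval 0 a2 a -> forall x, closure Om x ->
     u a x = u 0 x + rint (closed_interval 0 a) (fun s => g s x)).

Definition Aop1 N (a2 : R) (beta : R -> 'rV[R]_N -> R) (u : R -> 'rV[R]_N -> R)
  (x : 'rV[R]_N) : R :=
  - u 0 x + rint (open_interval 0 a2) (fun a => beta a x * u a x).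

(* second component of A(0,u), given the derivative g of u *)
Definition Aop2 N (Om : set 'rV[R]_N) (J : 'rV[R]_N -> R) (D : R)
  (mu : R -> 'rV[R]_N -> R) (u g : R -> 'rV[R]_N -> R) (a : R)
  (x : 'rV[R]_N) : R :=
  - g a x + D * (Kop J Om (u a) x - u a x) - mu a x * u a x.

(* (al + i b) is an eigenvalue of (the complexification of) A, with
   eigenvector (0, u1 + i u2) *)
Definition is_eigenvalue N (Om : set 'rV[R]_N) (J : 'rV[R]_N -> R) (D : R)
  (a2 : R) (beta mu : R -> 'rV[R]_N -> R) (al b : R) : Prop :=
  exists u1 u2 g1 g2 : R -> 'rV[R]_N -> R,
    W11 Om a2 u1 g1 /\ W11 Om a2 u2 g2 /\
    (exists a x, closed_interval 0 a2 a /\ closure Om x /\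
                 (u1 a x <> 0 \/ u2 a x <> 0)) /\
    (forall x, closure Om x -> Aop1 a2 beta u1 x = 0 /\ Aop1 a2 beta u2 x = 0) /\
    (forall x, closure Om x -> {ae leb, forall a, open_interval 0 a2 a ->
        Aop2 Om J D mu u1 g1 a x = al * u1 a x - b * u2 a x /\
        Aop2 Om J D mu u2 g2 a x = b * u1 a x + al * u2 a x}).

Definition is_real_eigenpair N (Om : set 'rV[R]_N) (J : 'rV[R]_N -> R) (D : R)
  (a2 : R) (beta mu : R -> 'rV[R]_N -> R) (lam : R) (u : R -> 'rV[R]_N -> R)
  : Prop :=
  exists g : R -> 'rV[R]_N -> R,
    W11 Om a2 u g /\
    (exists a x, closed_interval 0 a2 a /\ closure Om x /\ u a x <> 0) /\
    (forall x, closure Om x -> Aop1 a2 beta u x = 0) /\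
    (forall x, closure Om x -> {ae leb, forall a, open_interval 0 a2 a ->
        Aop2 Om J D mu u g a x = lam * u a x}).

Definition principal_eigenpair N (Om : set 'rV[R]_N) (J : 'rV[R]_N -> R)
  (D : R) (a2 : R) (beta mu : R -> 'rV[R]_N -> R) (lam : R)
  (phi : R -> 'rV[R]_N -> R) : Prop :=
  is_real_eigenpair Om J D a2 beta mu lam phi /\
  (forall a x, closed_interval 0 a2 a -> closure Om x -> 0 < phi a x) /\
  (forall al b, is_eigenvalue Om J D a2 beta mu al b ->
     (al <> lam \/ b <> 0) -> al < lam).

Definition strong_max_principle N (Om : set 'rV[R]_N) (J : 'rV[R]_N -> R)
  (D : R) (a2 : R) (beta mu : R -> 'rV[R]_N -> R) : Prop :=
  forall u g : R -> 'rV[R]_N -> R, W11 Om a2 u g ->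
    (forall x, Om x -> Aop1 a2 beta u x <= 0) ->
    (forall x, Om x -> {ae leb, forall a, open_interval 0 a2 a ->
        Aop2 Om J D mu u g a x <= 0}) ->
    (forall a x, closed_interval 0 a2 a -> Om x -> u a x = 0) \/
    (forall a x, closed_interval 0 a2 a -> Om x -> 0 < u a x).

End Defs.

(* Main.v *)
Require Import Defs.
From HB Require Import structures.
From mathcomp Require Import all_boot all_order all_algebra.
From mathcomp Require Import all_classical all_reals all_analysis.
From mathcomp Require Import measurable_realfun ring lra.
Set Implicit Arguments. Unset Strict Implicit. Unset Printing Implicit Defensive.
Import Order.TTheory GRing.Theory Num.Theory.
Import numFieldNormedType.Exports.
Local Open Scope classical_set_scope.
Local Open Scope ring_scope.

(** If [lam1 >= 0], the supersolution [- phi] violates the principle. Let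
    [lam1 < 0] and let [u] be a supersolution. If [u] were negative somewhere,
    put [m := - min (u / phi) > 0] and [w := u + m phi]: it is nonnegative and
    vanishes at some [(a0, x0)] with [x0] in the closure of [Om]. Near a zero
    with [a0 > 0] the terms in [w] are negligible and [- m lam1 phi] makes [w]
    grow at a fixed rate in [a] at all nearby points of [Om], so [w (a0, x0) > 0];
    if [a0 = 0], the birth law bounds [w (0, y)] from below for [y] in [Om] near
    [x0]. Hence [u >= 0]. If [u] is positive somewhere in [Om], positivity
    persists in age, spreads over the connected set [Om] through the nonlocal
    term since [J 0 > 0], and comes back to age [0] through the births near
    [a2].

    The integrands of [Kop] and [beta_low] are not shown to be measurable: the
    integral of an arbitrary function is a difference of lower integrals, hence
    monotone, homogeneous and insensitive to null sets. *)

Section unmeasured_integral.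
Context d (T : measurableType d) (R : realType) (mu : {measure set T -> \bar R}).
Local Open Scope ereal_scope.
Import HBNNSimple.

Lemma ae_ge0_le_integralW (D : set T) (f g : T -> \bar R) :
  (forall x, D x -> 0 <= f x) -> (forall x, D x -> 0 <= g x) ->
  {ae mu, forall x, D x -> f x <= g x} ->
  \int[mu]_(x in D) f x <= \int[mu]_(x in D) g x.
Proof.
move=> f0 g0 [N [mN N0 fgN]]; rewrite !ge0_integralE//.
apply: ge_ereal_sup => _ [h /= hf <-].
have mNC : measurable (~` N) by exact: measurableC.
pose h' := proj_nnsfun h mNC.
have -> : sintegral mu h = sintegral mu h'.
  rewrite -!integralT_nnsfun; apply: ge0_ae_eq_integral => //.
  - by apply/measurable_EFinP.
  - by apply/measurable_EFinP.
  - by move=> x _; rewrite lee_fin.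
  - by move=> x _; rewrite lee_fin.
  - exists N; split => // x /= h'x; apply: contrapT => Nx; apply: h'x => _.
    by rewrite /h' /= mindicE mem_set// mulr1.
apply: ereal_sup_ubound; exists h' => // x /=.
rewrite mindicE; have [xN|xN] := boolP (x \in ~` N); last first.
  rewrite mulr0 /patch; case: ifPn => //; rewrite inE; exact: g0.
rewrite mulr1; apply: le_trans (hf x) _.
rewrite /patch; case: ifPn => //; rewrite inE => Dx.
apply: contrapT => fg; move: xN; rewrite inE; apply; apply: fgN => /=.
by apply: contra_not fg; exact.
Qed.

Lemma ae_le_integral (D : set T) (f g : T -> \bar R) :
  {ae mu, forall x, D x -> f x <= g x} ->
  \int[mu]_(x in D) f x <= \int[mu]_(x in D) g x.
Proof.
move=> fg; rewrite (integralE _ _ f) (integralE _ _ g).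
apply: leeB; apply: ae_ge0_le_integralW => // ; apply: filterS fg => x fg Dx.
  by rewrite !funeposE ge_max !le_max fg// lexx orbT.
by rewrite !funenegE ge_max !le_max leeN2 fg// lexx orbT.
Qed.

Lemma ae_eq_integralW (D : set T) (f g : T -> \bar R) :
  {ae mu, forall x, D x -> f x = g x} ->
  \int[mu]_(x in D) f x = \int[mu]_(x in D) g x.
Proof.
move=> fg; apply/eqP; rewrite eq_le; apply/andP; split;
by apply: ae_le_integral; apply: filterS fg => x fg Dx; rewrite fg.
Qed.

Lemma integral_fin_num_bounded (D : set T) (f : T -> R) (M : R) :
  measurable D -> mu D < +oo ->
  {ae mu, forall x, D x -> (`|f x| <= M)%R} ->
  \int[mu]_(x in D) (f x)%:E \is a fin_num.
Proof.
move=> mD Doo fM; have fD : mu D \is a fin_num by rewrite ge0_fin_numE.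
have h1 : \int[mu]_(x in D) (f x)%:E <= M%:E * mu D.
  rewrite -integral_cst//; apply: ae_le_integral; apply: filterS fM => x fM Dx.
  by rewrite lee_fin (le_trans (ler_norm _))// fM.
have h2 : (- M)%:E * mu D <= \int[mu]_(x in D) (f x)%:E.
  rewrite -integral_cst//; apply: ae_le_integral; apply: filterS fM => x fM Dx.
  by rewrite lee_fin; move: (fM Dx); rewrite ler_norml => /andP[].
rewrite fin_numElt; apply/andP; split.
  by apply: lt_le_trans h2; rewrite ltNye_eq fin_numM.
by apply: le_lt_trans h1 _; rewrite ltey_eq fin_numM.
Qed.

Lemma ge0_le_integralZl (D : set T) (k : R) (f : T -> \bar R) : (0 < k)%R ->
  (forall x, D x -> 0 <= f x) ->
  k%:E * \int[mu]_(x in D) f x <= \int[mu]_(x in D) (k%:E * f x).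
Proof.
move=> k0 f0; have kf0 x : D x -> 0 <= k%:E * f x.
  by move=> Dx; rewrite mule_ge0 ?lee_fin ?(ltW k0) ?f0.
rewrite !ge0_integralE// -lee_pdivlMl//.
apply: ge_ereal_sup => _ [h /= hf <-]; rewrite lee_pdivlMl//.
rewrite -sintegralrM; apply: ereal_sup_ubound.
exists (scale_nnsfun h (ltW k0)) => // x /=.
rewrite EFinM; apply: (@le_trans _ _ (k%:E * (f \_ D) x)).
  by rewrite lee_pmul2l.
by rewrite /patch; case: ifPn; rewrite ?mule0.
Qed.

Lemma ge0_integralZlW (D : set T) (k : R) (f : T -> \bar R) : (0 < k)%R ->
  (forall x, D x -> 0 <= f x) ->
  \int[mu]_(x in D) (k%:E * f x) = k%:E * \int[mu]_(x in D) f x.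
Proof.
move=> k0 f0; apply/eqP; rewrite eq_le ge0_le_integralZl// andbT.
rewrite -lee_pdivrMl//.
have kf0 x : D x -> 0 <= k%:E * f x.
  by move=> Dx; rewrite mule_ge0 ?lee_fin ?(ltW k0) ?f0.
have ki0 : (0 < k^-1)%R by rewrite invr_gt0.
apply: le_trans (ge0_le_integralZl ki0 kf0) _.
apply: ae_le_integral; apply: aeW => x Dx.
by rewrite muleA -EFinM mulVf ?mul1e// gt_eqF.
Qed.

Let fineBC (a b : \bar R) : 0 <= a -> 0 <= b ->
  fine (b - a) = (- fine (a - b))%R.
Proof. by case: a => [a| |]; case: b => [b| |] //= _ _; rewrite ?oppr0// opprB. Qed.

Let fine_pMB (k : R) (a b : \bar R) : (0 < k)%R -> 0 <= a -> 0 <= b ->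
  fine (k%:E * a - k%:E * b) = (k * fine (a - b))%R.
Proof.
move=> k0; case: a => [a| |]; case: b => [b| |] //= _ _;
  by rewrite ?gt0_muley ?lte_fin//= ?mulr0// mulrBr.
Qed.

Lemma fine_integralN (D : set T) (f : T -> R) :
  fine (\int[mu]_(x in D) (- f x)%:E) = (- fine (\int[mu]_(x in D) (f x)%:E))%R.
Proof.
rewrite (integralE _ _ (fun x => (- f x)%:E)) (integralE _ _ (fun x => (f x)%:E)).
have -> : (fun x => (- f x)%:E)^\+ = (fun x => (f x)%:E)^\-.
  by rewrite -funeposN; congr funepos; apply/funext => x /=.
have -> : (fun x => (- f x)%:E)^\- = (fun x => (f x)%:E)^\+.
  by rewrite -funenegN; congr funeneg; apply/funext => x /=.
by rewrite fineBC//; apply: integral_ge0.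
Qed.

Lemma fine_integralZl (D : set T) (k : R) (f : T -> R) : (0 < k)%R ->
  fine (\int[mu]_(x in D) (k * f x)%:E) = (k * fine (\int[mu]_(x in D) (f x)%:E))%R.
Proof.
move=> k0.
have kE : (fun x => (k * f x)%:E) = (fun x => k%:E * (f x)%:E) by [].
rewrite (integralE _ _ (fun x => (k * f x)%:E)) (integralE _ _ (fun x => (f x)%:E)).
rewrite kE (ge0_funeposM _ (ltW k0)) (ge0_funenegM _ (ltW k0)).
by rewrite !ge0_integralZlW// fine_pMB//; apply: integral_ge0.
Qed.

End unmeasured_integral.

Section compact_support_integral.
Variable R : realType.
Local Notation leb := (@lebesgue_measure R).
Implicit Types (h : R -> R) (B M : R).

Lemma rint_supp h B : (forall t, B < `|t| -> h t = 0) ->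
  rint setT h = rint `[- B, B]%classic h.
Proof.
move=> hB; rewrite /rint [in RHS]integral_mkcond; congr fine.
apply: eq_integral => t _; rewrite /patch; case: ifPn => // /negP tB.
rewrite hB// ltNge; apply: contra_notN tB; rewrite ler_norml => tB.
by rewrite inE /= in_itv.
Qed.

Lemma leb_itv_le B : 0 <= B -> leb `[- B, B]%classic = (2 * B)%:E.
Proof.
move=> B0; rewrite lebesgue_measure_itv /=; case: ifPn => [_|].
  by rewrite -EFinB; congr EFin; ring.
rewrite lte_fin -leNgt => BB; have -> : B = 0 by lra.
by rewrite mulr0.
Qed.

Lemma rint_fin_num h B M : 0 <= B -> (forall t, `|h t| <= M) ->
  (\int[leb]_(t in `[(- B)%R, B]%classic) (h t)%:E)%E \is a fin_num.
Proof.
move=> B0 hM; apply: (@integral_fin_num_bounded _ _ _ _ _ _ M) => //.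
  rewrite [X in (X < _)%E](_ : _ = (2 * B)%:E) ?ltey//. exact: leb_itv_le.
exact: aeW.
Qed.

Lemma rint_bound h B M : 0 <= B -> (forall t, `|h t| <= M) ->
  (forall t, B < `|t| -> h t = 0) -> `|rint setT h| <= M * (2 * B).
Proof.
move=> B0 hM hB; rewrite (rint_supp hB) /rint.
have fE := fineK (rint_fin_num B0 hM).
rewrite ler_norml -!lee_fin fE; apply/andP; split.
  rewrite -mulNr EFinM -leb_itv_le// -integral_cst//.
  apply: ae_le_integral; apply: aeW => t _; rewrite lee_fin.
  by have := hM t; rewrite ler_norml => /andP[].
rewrite EFinM -leb_itv_le// -integral_cst//.
apply: ae_le_integral; apply: aeW => t _; rewrite lee_fin.
by have := hM t; rewrite ler_norml => /andP[].
Qed.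

Lemma le_rint_bounded h1 h2 B M : 0 <= B ->
  (forall t, `|h1 t| <= M) -> (forall t, B < `|t| -> h1 t = 0) ->
  (forall t, `|h2 t| <= M) -> (forall t, B < `|t| -> h2 t = 0) ->
  (forall t, h1 t <= h2 t) -> rint setT h1 <= rint setT h2.
Proof.
move=> B0 h1M h1B h2M h2B h12; rewrite (rint_supp h1B) (rint_supp h2B) /rint.
apply: fine_le; [exact: rint_fin_num|exact: rint_fin_num|].
by apply: ae_le_integral; apply: aeW => t _; rewrite lee_fin.
Qed.

Definition box_supp n (B : R) (f : 'rV[R]_n -> R) : Prop :=
  forall (v : 'rV[R]_n) i, B < `|v 0 i| -> f v = 0.

Lemma box_supp_row n B (f : 'rV[R]_n.+1 -> R) t : box_supp B f ->
  box_supp B (fun v : 'rV[R]_n => f (row_mx (const_mx t : 'rV[R]_1) v)).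
Proof.
by move=> fB v i vi; apply: (fB _ (rshift 1 i)); rewrite (@row_mxEr _ 1 1 n).
Qed.

Lemma box_supp_out n B (f : 'rV[R]_n.+1 -> R) t (v : 'rV[R]_n) : box_supp B f ->
  B < `|t| -> f (row_mx (const_mx t : 'rV[R]_1) v) = 0.
Proof.
by move=> fB tB; apply: (fB _ (@lshift 1 n ord0)); rewrite (@row_mxEl _ 1 1 n) mxE.
Qed.

Lemma iint_bound n (f : 'rV[R]_n -> R) B M : 0 <= B -> (forall v, `|f v| <= M) ->
  box_supp B f -> `|iint f| <= M * (2 * B) ^+ n.
Proof.
move=> B0; elim: n f M => [|n IH] f M fM fB; first by rewrite expr0 mulr1 fM.
rewrite [iint f]/= exprSr mulrA; apply: rint_bound => // [t|t tB].
  by apply: IH => //; exact: box_supp_row.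
apply/eqP; rewrite -normr_le0.
rewrite -[leRHS](mul0r ((2 * B) ^+ n)); apply: IH => [v|].
  by rewrite (box_supp_out _ fB tB) normr0.
exact: box_supp_row.
Qed.

Lemma iint_out n (f : 'rV[R]_n.+1 -> R) B t : 0 <= B -> box_supp B f -> B < `|t| ->
  iint (fun v : 'rV[R]_n => f (row_mx (const_mx t : 'rV[R]_1) v)) = 0.
Proof.
move=> B0 fB tB; apply/eqP; rewrite -normr_le0.
rewrite -[leRHS](mul0r ((2 * B) ^+ n)); apply: iint_bound => // [v|].
  by rewrite (box_supp_out _ fB tB) normr0.
exact: box_supp_row.
Qed.

Lemma le_iint n (f g : 'rV[R]_n -> R) B M : 0 <= B ->
  (forall v, `|f v| <= M) -> box_supp B f ->
  (forall v, `|g v| <= M) -> box_supp B g ->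
  (forall v, f v <= g v) -> iint f <= iint g.
Proof.
move=> B0; elim: n f g => [|n IH] f g fM fB gM gB fg; first exact: fg.
rewrite [iint f]/= [iint g]/=.
apply: (@le_rint_bounded _ _ B (M * (2 * B) ^+ n)) => // t.
- by apply: iint_bound => //; exact: box_supp_row.
- exact: iint_out.
- by apply: iint_bound => //; exact: box_supp_row.
- exact: iint_out.
- by apply: IH => //; exact: box_supp_row.
Qed.

Lemma iint_ge0 n (f : 'rV[R]_n -> R) : (forall v, 0 <= f v) -> 0 <= iint f.
Proof.
elim: n f => [|n IH] f f0; first exact: f0.
rewrite [iint f]/=; apply: fine_ge0; apply: integral_ge0 => t _.
by rewrite lee_fin IH.
Qed.

Lemma iintN n (f : 'rV[R]_n -> R) : iint (fun v => - f v) = - iint f.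
Proof.
elim: n f => [//|n IH] f; rewrite [iint f]/= [LHS]/=.
rewrite /rint -fine_integralN; congr fine; apply: eq_integral => t _.
by rewrite IH.
Qed.

Lemma iintZ n (f : 'rV[R]_n -> R) k : 0 < k ->
  iint (fun v => k * f v) = k * iint f.
Proof.
move=> k0; elim: n f => [//|n IH] f; rewrite [iint f]/= [LHS]/=.
rewrite /rint -fine_integralZl//; congr fine; apply: eq_integral => t _.
by rewrite IH.
Qed.

Lemma iint_box n (x : 'rV[R]_n) (c r : R) : 0 < r ->
  iint (fun v : 'rV[R]_n => c * [forall i, `|v 0 i - x 0 i| < r]%:R) = c * (2 * r) ^+ n.
Proof.
move=> r0; elim: n x c => [|n IH] x c.
  rewrite /= expr0; congr (_ * _).
  by have -> : [forall i : 'I_0, `|(0 : 'rV[R]_0) 0 i - x 0 i| < r] = true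
    by apply/forallP => -[].
pose b (t : R) : R := (`|t - x 0 0| < r)%R%:R.
rewrite [LHS]/=.
transitivity (rint setT (fun t => c * b t * (2 * r) ^+ n)).
  rewrite /rint; congr fine; apply: eq_integral => t _; congr EFin.
  rewrite -(IH (@rsubmx R 1 1 n x)); congr iint; apply/funext => v.
  rewrite -mulrA; congr (_ * _); rewrite /b -natrM mulnb; congr (_%:R).
  congr nat_of_bool; apply/forallP/andP => [h|[h0 /forallP h] i].
    split.
      have := h (@lshift 1 n ord0); rewrite (@row_mxEl _ 1 1 n) mxE.
      by have -> : @lshift 1 n ord0 = 0 by apply/val_inj.
    by apply/forallP => i; have := h (rshift 1 i); rewrite (@row_mxEr _ 1 1 n) mxE.
  case: (@splitP 1 n i) => j ij.
    have -> : i = @lshift 1 n j by exact/val_inj.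
    rewrite (@row_mxEl _ 1 1 n) mxE.
    by have -> : @lshift 1 n j = 0 by apply/val_inj; case: j {ij} => -[].
  have -> : i = rshift 1 j by exact/val_inj.
  by rewrite (@row_mxEr _ 1 1 n); have := h j; rewrite mxE.
transitivity (rint `]x 0 0 - r, x 0 0 + r[%classic (cst (c * (2 * r) ^+ n))).
  rewrite /rint [in RHS]integral_mkcond; congr fine.
  apply: eq_integral => t _; rewrite /patch /b.
  have -> : (`|t - x 0 0| < r) = (t \in `]x 0 0 - r, x 0 0 + r[%classic).
    by rewrite ltr_distl; apply/idP/idP; rewrite inE /= in_itv.
  by case: ifPn; rewrite ?mulr1// mulr0 mul0r.
rewrite /rint (integral_cst _ _ (c * (2 * r) ^+ n)%:E)//.
rewrite [X in (_ * X)%E](_ : _ = (2 * r)%:E); last first.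
  rewrite [LHS]lebesgue_measure_itv/= lte_fin ifT; last by lra.
  by rewrite -EFinB; congr EFin; ring.
by rewrite -EFinM /= exprSr; ring.
Qed.

End compact_support_integral.

Section dispersal_operator.
Variables (R : realType) (N : nat) (J : 'rV[R]_N -> R) (Om : set 'rV[R]_N).
Implicit Types f : 'rV[R]_N -> R.

Lemma Kop_ge0 f x : (forall y, 0 <= J y) -> (forall y, Om y -> 0 <= f y) ->
  0 <= Kop J Om f x.
Proof.
move=> J0 f0; apply: iint_ge0 => y; rewrite indicE.
have [/set_mem Oy|_] := boolP (y \in Om); last by rewrite !mul0r.
by rewrite mul1r mulr_ge0// f0.
Qed.

Lemma KopN f x : Kop J Om (fun y => - f y) x = - Kop J Om f x.
Proof.
by rewrite /Kop -iintN; congr iint; apply/funext => y; rewrite mulrN.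
Qed.

Lemma KopZ f x k : 0 < k -> Kop J Om (fun y => k * f y) x = k * Kop J Om f x.
Proof.
by move=> k0; rewrite /Kop -iintZ//; congr iint; apply/funext => y; rewrite mulrCA.
Qed.

Lemma norm_coord_le (v : 'rV[R]_N) i : `|v 0 i| <= `|v|.
Proof.
rewrite [leRHS]/Num.Def.normr/= mx_normrE.
exact: (le_bigmax_cond _ (fun ij : 'I_1 * 'I_N => `|v ij.1 ij.2|) (j := (0, i))).
Qed.

Variables (B MJ : R).
Hypothesis OmB : forall y, Om y -> `|y| <= B.
Hypothesis JM : forall y, `|J y| <= MJ.

Lemma Kop_integrand_bound f x M : (forall y, Om y -> `|f y| <= M) -> 0 <= M ->
  forall y, `|(\1_Om y : R) * J (x - y) * f y| <= MJ * M.
Proof.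
move=> fM M0 y; have MJ0 : 0 <= MJ by apply: le_trans (JM 0).
rewrite indicE.
have [/set_mem Oy|_] := boolP (y \in Om); last first.
  by rewrite !mul0r normr0 mulr_ge0.
by rewrite mul1r normrM ler_pM// fM.
Qed.

Lemma Kop_integrand_supp f x :
  box_supp B (fun y => (\1_Om y : R) * J (x - y) * f y).
Proof.
move=> y i yB; rewrite indicE.
have [/set_mem Oy|_] := boolP (y \in Om); last by rewrite !mul0r.
have := le_trans (norm_coord_le y i) (OmB Oy).
by move=> /(lt_le_trans yB); rewrite ltxx.
Qed.

Lemma le_Kop f g x M : Om !=set0 -> (forall y, 0 <= J y) ->
  (forall y, Om y -> `|f y| <= M) -> (forall y, Om y -> `|g y| <= M) ->
  (forall y, Om y -> f y <= g y) -> Kop J Om f x <= Kop J Om g x.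
Proof.
move=> [z Oz] J0 fM gM fg; have M0 : 0 <= M by apply: le_trans (fM _ Oz).
have B0 : 0 <= B by apply: le_trans (OmB Oz).
apply: (@le_iint _ _ _ _ B (MJ * M)) => //.
- exact: Kop_integrand_bound.
- exact: Kop_integrand_supp.
- exact: Kop_integrand_bound.
- exact: Kop_integrand_supp.
move=> y; rewrite indicE.
have [/set_mem Oy|_] := boolP (y \in Om); last by rewrite !mul0r.
by rewrite mul1r ler_wpM2l// fg.
Qed.

Lemma Kop_lower f (x : 'rV[R]_N) M (z : 'rV[R]_N) (r c1 c2 : R) :
  0 < r -> 0 <= c1 -> 0 <= c2 ->
  (forall y, 0 <= J y) -> (forall y, Om y -> 0 <= f y <= M) ->
  (forall y : 'rV[R]_N, `|y - z| <= r -> [/\ Om y, c1 <= J (x - y) & c2 <= f y]) ->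
  c1 * c2 * (2 * r) ^+ N <= Kop J Om f x.
Proof.
move=> r0 c10 c20 J0 fM zr.
have [Oz zc1 zc2] : [/\ Om z, c1 <= J (x - z) & c2 <= f z].
  by apply: zr; rewrite subrr normr0 ltW.
have /andP[fz0 fzM] := fM _ Oz.
have B0 : 0 <= B by apply: le_trans (OmB Oz).
have c1M : c1 <= MJ by apply: le_trans zc1 (le_trans (ler_norm _) (JM _)).
have c2M : c2 <= M by apply: le_trans zc2 _.
have boxP (y : 'rV[R]_N) : [forall i, `|y 0 i - z 0 i| < r] -> `|y - z| <= r.
  move=> /forallP yz; rewrite [leLHS]/Num.Def.normr/= mx_normrE.
  apply: bigmax_le; first exact: ltW.
  by move=> [i j] _ /=; rewrite !mxE (ord1 i) ltW.
rewrite -(iint_box z)//.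
apply: (@le_iint _ _ _ _ B (MJ * M)) => //.
- move=> y; rewrite normrM ger0_norm ?mulr_ge0//.
  rewrite -[leRHS]mulr1 ler_pM// ?mulr_ge0// ?ler_pM//.
  by case: [forall _, _]; rewrite ?normr1 ?normr0.
- move=> y i yB; case: (boolP [forall i, `|y 0 i - z 0 i| < r]); last by rewrite mulr0.
  move=> /boxP/zr[/OmB yB' _ _].
  by have := lt_le_trans yB (le_trans (norm_coord_le y i) yB'); rewrite ltxx.
- apply: Kop_integrand_bound; last exact: le_trans fzM.
  by move=> y /fM /andP[f0 fM']; rewrite ger0_norm.
- exact: Kop_integrand_supp.
move=> y; have [/boxP/zr[Oy h1 h2]|_] := boolP [forall i, `|y 0 i - z 0 i| < r]; last first.
  rewrite mulr0 indicE; have [/set_mem Oy|_] := boolP (y \in Om); last by rewrite !mul0r.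
  by rewrite mul1r mulr_ge0//; case/andP: (fM _ Oy).
by rewrite mulr1 indicE mem_set// mul1r ler_pM.
Qed.

End dispersal_operator.

Section intervals.
Variable R : realType.

Lemma open_intervalE (a b : R) : open_interval a b = `]a, b[%classic.
Proof. by apply/seteqP; split => t; rewrite /open_interval /= in_itv. Qed.

Lemma closed_intervalE (a b : R) : closed_interval a b = `[a, b]%classic.
Proof. by apply/seteqP; split => t; rewrite /closed_interval /= in_itv. Qed.

Lemma measurable_open_interval (a b : R) : measurable (open_interval a b).
Proof. by rewrite open_intervalE. Qed.

Lemma leb_itv_oc (a b : R) : a <= b ->
  @lebesgue_measure R `]a, b]%classic = (b - a)%:E.
Proof.
move=> ab; rewrite lebesgue_measure_itv/= lte_fin; case: ifPn => //.
by rewrite -leNgt => ba; have -> : a = b; [apply/le_anti; rewrite ab|rewrite subrr].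
Qed.

Lemma ae_neq (c : R) : {ae (@lebesgue_measure R), forall a, a != c}.
Proof.
exists [set c]; split => //; first exact: lebesgue_measure_set1.
by move=> a /= /negP; rewrite negbK => /eqP.
Qed.

Lemma ae_lebesgue_filter : Filter (almost_everywhere (@lebesgue_measure R)).
Proof. exact: (ae_filter_ringOfSetsType (@lebesgue_measure R)). Qed.

End intervals.

#[local] Hint Extern 0 (Filter (nbhs (almost_everywhere lebesgue_measure))) =>
  (apply: ae_lebesgue_filter) : typeclass_instances.

Section sobolev.
Variables (R : realType) (N : nat) (Om : set 'rV[R]_N) (a2 : R).
Local Notation leb := (@lebesgue_measure R).
Implicit Types (u g : R -> 'rV[R]_N -> R).

Definition sup_norm (g : R -> 'rV[R]_N -> R) (a : R) : \bar R :=
  ereal_sup [set (`|g a x|)%:E | x in closure Om].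

Lemma sup_norm_ge0 g a x : closure Om x -> (0 <= sup_norm g a)%E.
Proof.
move=> Ox; apply: le_trans (ereal_sup_ubound _); last by exists x.
by rewrite lee_fin.
Qed.

Lemma L1C_representative g x : L1C Om a2 g -> closure Om x ->
  exists g' : R -> R,
    [/\ leb.-integrable setT (EFin \o g'),
        {ae leb, forall a, open_interval 0 a2 a -> g' a = g a x} &
        forall a, (`|g' a|%:E <= (sup_norm g \_ (open_interval 0 a2)) a)%E].
Proof.
move=> [[k [A [c [mA [_ [Z [mZ Z0 cvZ]]]]]]] goo] Ox.
pose I := open_interval 0 a2; pose F := I `&` ~` Z.
have mI : measurable I by exact: measurable_open_interval.
have mF : measurable F by apply: measurableI => //; exact: measurableC.
pose g' := (g^~ x) \_ F.
have cvF a : F a -> forall e : R, 0 < e -> exists n0, forall n, (n0 <= n)%N ->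
    `|\sum_(i < k n) (\1_(A n i) a : R) * c n i x - g a x| <= e.
  move=> [Ia Za] e e0; apply: contrapT => h; apply: Za; apply: cvZ => /= H.
  apply: h; have [n0 Hn0] := H Ia e e0.
  by exists n0 => n nn0; exact: Hn0.
have mg' : measurable_fun setT g'.
  apply/(measurable_restrictT _ mF).
  apply: (@measurable_fun_cvg _ _ _ _
    (fun n a => \sum_(i < k n) (\1_(A n i) a : R) * c n i x)).
    move=> n; apply: measurable_sum => i; apply: measurable_funM => //.
  move=> a Fa; apply/cvgrPdist_le => e e0; have [n0 H] := cvF _ Fa e e0.
  by exists n0 => // n /= nn0; rewrite distrC; exact: H.
have bg' a : (`|g' a|%:E <= (sup_norm g \_ I) a)%E.
  rewrite /g' /patch; have [|] := boolP (a \in F).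
    rewrite inE => -[Ia _]; rewrite mem_set//.
    by apply: ereal_sup_ubound; exists x.
  rewrite normr0 => _; case: ifPn => // _; exact: sup_norm_ge0 Ox.
exists g'; split => //.
- apply/integrableP; split; first exact/measurable_EFinP.
  apply: le_lt_trans goo; rewrite [leRHS]integral_mkcond.
  by apply: ae_le_integral; apply: aeW => a _ /=; exact: bg'.
- exists Z; split => // a /= h; apply: contrapT => Za; apply: h => Ia.
  by rewrite /g' /patch mem_set//; split.
Qed.

Lemma W11_representative u g x : W11 Om a2 u g -> closure Om x ->
  exists g' : R -> R,
    [/\ leb.-integrable setT (EFin \o g'),
        {ae leb, forall a, open_interval 0 a2 a -> g' a = g a x},
        forall a, (`|g' a|%:E <= (sup_norm g \_ (open_interval 0 a2)) a)%E &
        forall a b, 0 <= a -> a <= b -> b <= a2 ->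
          u b x - u a x = Rintegral leb `]a, b]%classic g'].
Proof.
move=> [_ [gL uE]] Ox; have [g' [ig' g'E g'b]] := L1C_representative gL Ox.
exists g'; split => // a b a0 ab ba2.
have rE c : 0 <= c <= a2 -> u c x = u 0 x + Rintegral leb `[0, c]%classic g'.
  move=> c0; rewrite (uE _ c0)//; congr +%R; rewrite /rint closed_intervalE.
  congr fine; apply: ae_eq_integralW.
  near=> s => /=; rewrite in_itv /= => /andP[s0 sc]; congr EFin.
  have s0' : s != 0 by near: s; exact: ae_neq.
  have s2' : s != a2 by near: s; exact: ae_neq.
  have h : open_interval 0 a2 s -> g' s = g s x by near: s.
  rewrite h// /open_interval /= lt_neqAle eq_sym s0' s0 /=.
  by rewrite lt_neqAle s2' (le_trans sc)//; case/andP: c0.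
rewrite (rE b) ?(le_trans a0)//= (rE a) ?a0 ?(le_trans ab)//=.
rewrite opprD addrACA subrr add0r (Rintegral_itvB (b := BRight b))//.
by apply: integrableS ig'.
Unshelve. all: by end_near. Qed.

(* A failure of equicontinuity picks countably many points [x n]; the supremum
   of the corresponding derivatives is measurable and integrable, and absolute
   continuity of its integral gives the contradiction. *)
Lemma W11_equicontinuous u g (e : R) : W11 Om a2 u g -> 0 < e ->
  exists2 d : R, 0 < d & forall x a b, closure Om x -> 0 <= a -> a <= b ->
    b <= a2 -> b - a <= d -> `|u b x - u a x| <= e.
Proof.
move=> uW e0; apply: contrapT => nequi.
have H1 (n : nat) : exists p : 'rV[R]_N * R * R * (R -> R),
    [/\ [/\ closure Om p.1.1.1, 0 <= p.1.1.2, p.1.1.2 <= p.1.2 & p.1.2 <= a2],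
        p.1.2 - p.1.1.2 <= n.+1%:R^-1 & e < `|u p.1.2 p.1.1.1 - u p.1.1.2 p.1.1.1| ] /\
    [/\ leb.-integrable setT (EFin \o p.2),
        forall a, (`|p.2 a|%:E <= (sup_norm g \_ (open_interval 0 a2)) a)%E &
        u p.1.2 p.1.1.1 - u p.1.1.2 p.1.1.1 = Rintegral leb `]p.1.1.2, p.1.2]%classic p.2].
  apply: contrapT => h; apply: nequi; exists n.+1%:R^-1 => // x a b Ox a0 ab ba2 bad.
  rewrite leNgt; apply/negP => eu; apply: h.
  have [g' [ig' g'E g'b uE]] := W11_representative uW Ox.
  by exists (x, a, b, g'); split; split => //=; exact: uE.
have [p {}H1] := choice H1.
pose H s : \bar R := esups (fun n => `|(p n).2 s|%:E) 0%N.
have pH n s : (`|(p n).2 s|%:E <= H s)%E by apply: ereal_sup_ubound; exists n.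
have H0 s : (0 <= H s)%E by apply: le_trans (pH 0%N s).
have mH : measurable_fun setT H.
  apply: (@measurable_fun_esups _ _ _ setT (fun n s => `|(p n).2 s|%:E)) => n.
  apply/measurable_EFinP; apply: measurableT_comp => //.
  by have [_ [/(measurable_int leb)/measurable_EFinP]] := H1 n.
have iH : leb.-integrable setT H.
  apply/integrableP; split => //.
  have [_ [[_ goo] _]] := uW; apply: le_lt_trans goo.
  rewrite [leRHS]integral_mkcond.
  apply: ae_le_integral; apply: aeW => s _; rewrite gee0_abs//.
  by apply: ge_ereal_sup => _ [n _ <-]; have [_ [_ + _]] := H1 n; apply.
pose h := fine \o H.
have ih : leb.-integrable setT (EFin \o h).
  apply: (le_integrable _ _ _ iH) => //.
    by apply/measurable_EFinP; apply: measurableT_comp => //; exact: fine_measurable.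
  by move=> s _ /=; rewrite /h /=; case: (H s) => [r| |] /=; rewrite ?leey ?lexx.
have [d [d0 dP]] := integral_normr_continuous ih e0.
have [n nd] : exists n : nat, n.+1%:R^-1 < d.
  exists (Num.truncn d^-1); rewrite -[ltRHS]invrK ltf_pV2 ?posrE ?invr_gt0//.
  exact: truncnS_gt.
have [[[Ox a0 ab ba2] bad eu] [ip _ uE]] := H1 n.
set x := (p n).1.1.1 in Ox eu uE; set a := (p n).1.1.2 in a0 ab bad eu uE.
set b := (p n).1.2 in ab ba2 bad eu uE.
have mab : measurable `]a, b]%classic by [].
have lab : (leb `]a, b]%classic < d%:E)%E.
  by rewrite leb_itv_oc// lte_fin (le_lt_trans bad nd).
have := dP _ mab lab.
apply/negP; rewrite -leNgt; apply: (le_trans (ltW eu)); rewrite uE.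
have ipab : leb.-integrable `]a, b]%classic (EFin \o (p n).2) by apply: integrableS ip.
apply: le_trans (le_normr_Rintegral _ ipab) _ => //.
have ihab : leb.-integrable `]a, b]%classic (EFin \o h) by apply: integrableS ih.
apply: fine_le.
- apply: integrable_fin_num => //; exact: integrable_norm.
- apply: integrable_fin_num => //; exact: integrable_norm.
apply: ae_le_integral; have Hfin := integrable_ae measurableT iH.
apply: filterS Hfin => s /(_ I) Hs _; rewrite lee_fin.
rewrite -lee_fin (le_trans (pH n s))// -(fineK Hs) lee_fin.
exact: ler_norm.
Qed.

End sobolev.

Lemma within_continuous_dist (R : realType) (V W : normedModType R) (A : set V)
    (f : V -> W) :
  {within A, continuous f} <->
  (forall x, A x -> forall e : R, 0 < e ->
    exists2 d : R, 0 < d & forall y, A y -> `|y - x| < d -> `|f y - f x| <= e).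
Proof.
rewrite subspace_continuousP; split => H x Ax.
  move=> e e0; have /cvgrPdist_le/(_ e e0) := H x Ax.
  rewrite near_withinE => /nbhs_normP[d /= d0 dP]; exists d => // y Ay yx.
  by rewrite distrC; apply: dP => //=; rewrite distrC.
apply/cvgrPdist_le => e e0; have [d d0 dP] := H x Ax e e0.
rewrite near_withinE; apply/nbhs_normP; exists d => //= y /=.
by rewrite distrC => yx Ay; rewrite distrC; exact: dP.
Qed.

Lemma nbhs_dist_lt (R : realType) (V : normedModType R) (x : V) (d : R) :
  0 < d -> nbhs x [set y | `|y - x| < d].
Proof. by move=> d0; apply/nbhs_normP; exists d => // y /=; rewrite distrC. Qed.

Section sobolev_continuity.
Variables (R : realType) (N : nat) (Om : set 'rV[R]_N) (a2 : R).
Local Notation leb := (@lebesgue_measure R).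
Implicit Types (u g : R -> 'rV[R]_N -> R).

Lemma W11_equicontinuous_dist u g (e : R) : W11 Om a2 u g -> 0 < e ->
  exists2 d : R, 0 < d & forall x a b, closure Om x -> 0 <= a <= a2 ->
    0 <= b <= a2 -> `|b - a| <= d -> `|u b x - u a x| <= e.
Proof.
move=> uW e0; have [d d0 dP] := W11_equicontinuous uW e0; exists d => // x a b Ox.
move=> /andP[a0 aa2] /andP[b0 ba2]; have [ab|/ltW ba] := leP a b => abd.
  by apply: dP => //; apply: le_trans abd; exact: ler_norm.
rewrite distrC; apply: dP => //; apply: le_trans abd; rewrite distrC; exact: ler_norm.
Qed.

Lemma W11_continuous_unif u g x (e : R) : W11 Om a2 u g -> closure Om x -> 0 < e ->
  exists2 d : R, 0 < d & forall a y, 0 <= a <= a2 -> closure Om y ->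
    `|y - x| < d -> `|u a y - u a x| <= e.
Proof.
move=> uW Ox e0; have e30 : 0 < e / 3 by rewrite divr_gt0.
have [h h0 hP] := W11_equicontinuous_dist uW e30.
have step (n : nat) : exists2 d : R, 0 < d & forall a y, 0 <= a <= a2 ->
    a <= n%:R * h -> closure Om y -> `|y - x| < d -> `|u a y - u a x| <= e.
  have at_t t : 0 <= t <= a2 -> exists2 d : R, 0 < d & forall a y, 0 <= a <= a2 ->
      `|a - t| <= h -> closure Om y -> `|y - x| < d -> `|u a y - u a x| <= e.
    move=> t0; have [cu _] := uW.
    have [d d0 dP] := (within_continuous_dist _ _).1 (cu _ t0) x Ox _ e30.
    exists d => // a y a0 ath Oy yx.
    have h1 := hP _ _ _ Oy t0 a0 ath; have h2 := dP _ Oy yx.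
    have h3 := hP _ _ _ Ox t0 a0 ath.
    have -> : u a y - u a x = (u a y - u t y) + (u t y - u t x) - (u a x - u t x).
      by ring.
    apply: le_trans (ler_normB _ _) _.
    have := ler_normD (u a y - u t y) (u t y - u t x).
    by lra.
  elim: n => [|n [d d0 dP]].
    have [a20|] := boolP (0 <= a2); last first.
      by move=> /negP a20; exists 1 => // a y /andP[a0 /(le_trans a0)].
    have [|d d0 dP] := at_t 0; first by rewrite lexx.
    exists d => // a y a0; rewrite mul0r => a0'; apply: dP => //.
    have -> : a = 0 by move: a0 => /andP[a0 _]; apply/le_anti; rewrite a0' a0.
    by rewrite subrr normr0 ltW.
  have [nh|nh] := leP (n%:R * h) a2; last first.
    exists d => // a y /andP[a0 aa2] _ Oy yx; apply: dP => //; first by rewrite a0.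
    by rewrite (le_trans aa2)// ltW.
  have [|d' d'0 d'P] := at_t (n%:R * h); first by rewrite nh andbT mulr_ge0 ?ler0n ?(ltW h0).
  exists (Num.min d d'); first by rewrite lt_min d0.
  move=> a y a0 anh Oy; rewrite lt_min => /andP[yd yd'].
  have [an|an] := leP a (n%:R * h); first exact: dP.
  apply: d'P => //; rewrite ger0_norm ?subr_ge0 ?(ltW an)//.
  by move: anh; rewrite -natr1 mulrDl mul1r lerBlDl.
have [d d0 dP] := step (Num.truncn (a2 / h)).+1; exists d => // a y a0 Oy yx.
apply: dP => //; case/andP: a0 => _ /le_trans; apply.
by rewrite -ler_pdivrMr// ltW// truncnS_gt.
Qed.

Lemma W11_continuous_joint u g x t (e : R) : W11 Om a2 u g -> closure Om x ->
  0 <= t <= a2 -> 0 < e ->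
  exists2 d : R, 0 < d & forall s y, 0 <= s <= a2 -> closure Om y ->
    `|s - t| <= d -> `|y - x| < d -> `|u s y - u t x| <= e.
Proof.
move=> uW Ox t0 e0; have e20 : 0 < e / 2 by rewrite divr_gt0.
have [h h0 hP] := W11_equicontinuous_dist uW e20.
have [d d0 dP] := W11_continuous_unif uW Ox e20.
exists (Num.min h d); first by rewrite lt_min h0.
move=> s y s0 Oy; rewrite le_min lt_min => /andP[sh _] /andP[_ yd].
have -> : u s y - u t x = (u s y - u s x) + (u s x - u t x) by ring.
apply: le_trans (ler_normD _ _) _.
by have := hP _ _ _ Ox t0 s0 sh; have := dP _ _ s0 Oy yd; lra.
Qed.

Lemma W11_continuous_time u g x : W11 Om a2 u g -> closure Om x ->
  {within `[0, a2]%classic, continuous (fun a => u a x)}.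
Proof.
move=> uW Ox; apply/(@within_continuous_dist R R^o R^o) => a /=.
rewrite in_itv /= => a0 e e0.
have [d d0 dP] := W11_equicontinuous_dist uW e0; exists d => // b /=.
rewrite in_itv /= => b0 /ltW; exact: dP.
Qed.

Lemma W11_continuous_prod u g : W11 Om a2 u g ->
  {within `[0, a2]%classic `*` closure Om, continuous (fun p => u p.1 p.2)}.
Proof.
move=> uW; apply/subspace_continuousP => -[t x] [/= ta Ox].
move: ta; rewrite in_itv /= => t0.
apply/cvgrPdist_le => e e0; have [d d0 dP] := W11_continuous_joint uW Ox t0 e0.
rewrite near_withinE /=.
exists ([set s | `|s - t| < d], [set y | `|y - x| < d]).
  by split => /=; [exact: (@nbhs_dist_lt R R^o)|exact: nbhs_dist_lt].
move=> [s y] [/= sd yd] [/=]; rewrite in_itv /= => s0 Oy.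
by rewrite distrC; apply: dP => //; exact: ltW.
Qed.

Lemma W11_bounded u g : 0 <= a2 -> compact (closure Om) -> Om !=set0 ->
  W11 Om a2 u g ->
  exists2 M : R, 0 <= M & forall a x, 0 <= a <= a2 -> closure Om x -> `|u a x| <= M.
Proof.
move=> a20 cOm [z Oz] uW.
have cK : compact (`[0, a2]%classic `*` closure Om).
  by apply: compact_setX => //; exact: segment_compact.
have /compact_bounded[M [_ MP]] := continuous_compact (W11_continuous_prod uW) cK.
have bM a x : 0 <= a <= a2 -> closure Om x -> `|u a x| <= `|M| + 1.
  move=> a0 Ox; apply: MP; first by rewrite (le_lt_trans (ler_norm _))// ltrDl.
  by exists (a, x) => //; split => //=; rewrite in_itv.
exists (`|M| + 1) => //.
Qed.

Lemma W11_growth2 u g v h x (m a b kap : R) : W11 Om a2 u g -> W11 Om a2 v h ->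
  closure Om x -> 0 <= a -> a <= b -> b <= a2 ->
  {ae leb, forall s, open_interval 0 a2 s -> a < s <= b -> kap <= g s x + m * h s x} ->
  kap * (b - a) <= (u b x + m * v b x) - (u a x + m * v a x).
Proof.
move=> uW vW Ox a0 ab ba2 gk.
have [g' [ig' g'E _ uE]] := W11_representative uW Ox.
have [h' [ih' h'E _ vE]] := W11_representative vW Ox.
have -> : u b x + m * v b x - (u a x + m * v a x) =
    (u b x - u a x) + m * (v b x - v a x) by ring.
have ig : leb.-integrable `]a, b]%classic (EFin \o g') by apply: integrableS ig'.
have ih : leb.-integrable `]a, b]%classic (EFin \o h') by apply: integrableS ih'.
have imh : leb.-integrable `]a, b]%classic (EFin \o (fun s => m * h' s)).
  by have := integrableZl _ m ih; exact.
rewrite uE// vE// -RintegralZl// -RintegralD// /Rintegral -lee_fin fineK; last first.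
  apply: integrable_fin_num => //.
  by have := integrableD _ ig imh; exact.
rewrite EFinM -(leb_itv_oc ab) -integral_cst//; apply: ae_le_integral.
near=> s => /=; rewrite in_itv /= => /andP[sa sb]; rewrite lee_fin.
have s2' : s != a2 by near: s; exact: ae_neq.
have Is : open_interval 0 a2 s.
  by rewrite /open_interval /= (le_lt_trans a0 sa) lt_neqAle s2' (le_trans sb).
have e1 : open_interval 0 a2 s -> g' s = g s x by near: s.
have e2 : open_interval 0 a2 s -> h' s = h s x by near: s.
have e3 : open_interval 0 a2 s -> a < s <= b -> kap <= g s x + m * h s x by near: s.
by rewrite e1// e2// e3// sa sb.
Unshelve. all: by end_near. Qed.

Lemma W11_growth u g x (a b kap : R) : W11 Om a2 u g -> closure Om x ->
  0 <= a -> a <= b -> b <= a2 ->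
  {ae leb, forall s, open_interval 0 a2 s -> a < s <= b -> kap <= g s x} ->
  kap * (b - a) <= u b x - u a x.
Proof.
move=> uW Ox a0 ab ba2 gk.
have := @W11_growth2 u g u g x 0 a b kap uW uW Ox a0 ab ba2.
rewrite !mul0r !addr0; apply.
move: gk; apply: filterS => s gk Is sab.
by rewrite mul0r addr0 gk.
Qed.

Lemma W11N u g : W11 Om a2 u g -> W11 Om a2 (fun a x => - u a x) (fun a x => - g a x).
Proof.
move=> [cu [[[k [A [c [mA [cc cvg]]]]] goo] uE]]; split; last split.
- move=> a a0; apply/within_continuous_dist => x Ox e e0.
  have [d d0 dP] := (within_continuous_dist _ _).1 (cu _ a0) x Ox _ e0.
  by exists d => // y Oy yx; rewrite -opprD normrN dP.
- split.
    exists k, A, (fun n i x => - c n i x); split => //; split.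
      move=> n i; apply/within_continuous_dist => x Ox e e0.
      have [d d0 dP] := (within_continuous_dist _ _).1 (cc n i) x Ox _ e0.
      by exists d => // y Oy yx; rewrite -opprD normrN dP.
    apply: filterS cvg => a cvg Ia e e0; have [n0 n0P] := cvg Ia e e0.
    exists n0 => n nn0 x Ox; rewrite -normrN opprD opprK -sumrN.
    by under eq_bigr do rewrite mulrN opprK; exact: n0P.
  by under eq_integral do under eq_imagel do rewrite normrN.
- move=> a a0 x Ox; rewrite (uE _ a0)// opprD; congr +%R.
  by rewrite /rint fine_integralN.
Qed.

End sobolev_continuity.

Section closure_bounds.
Variables (R : realType) (N : nat).
Implicit Types (A : set 'rV[R]_N).

Lemma closure_dist A (x : 'rV[R]_N) (d : R) : closure A x -> 0 < d ->
  exists2 y, A y & `|y - x| < d.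
Proof. by move=> Ax d0; have [y [Ay yx]] := Ax _ (nbhs_dist_lt x d0); exists y. Qed.

Lemma compact_closure_bounded A (M : R) : (forall x, A x -> `|x| <= M) ->
  compact (closure A).
Proof.
move=> AM; apply: bounded_closed_compact; last exact: closed_closure.
exists (M + 1); split; first exact: num_real.
move=> t Mt x Ax; have [y Ay yx] := closure_dist Ax ltr01.
apply: le_trans (ltW Mt); have -> : x = y - (y - x) by rewrite opprB addrC subrK.
by apply: le_trans (ler_normB _ _) _; apply: lerD; [exact: AM|exact: ltW].
Qed.

Lemma compact_support_bounded (J : 'rV[R]_N -> R) (r : R) : continuous J ->
  (forall y, r <= `|y| -> J y = 0) -> exists2 M : R, 0 <= M & forall y, `|J y| <= M.
Proof.
move=> cJ Jr; pose A := [set y : 'rV[R]_N | `|y| <= r].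
have cA : compact (closure A) by apply: (@compact_closure_bounded _ r).
have cJA : {within closure A, continuous J} by exact: continuous_subspaceT.
have /compact_bounded[M [_ MP]] := continuous_compact cJA cA.
have MM : M < `|M| + 1 by rewrite (le_lt_trans (ler_norm _))// ltrDl.
have M0 : 0 <= `|M| + 1 by rewrite addr_ge0.
exists (`|M| + 1) => // y; have [yr|/ltW yr] := leP `|y| r.
  by apply: MP => //; exists y => //; exact: subset_closure.
by rewrite Jr// normr0.
Qed.

End closure_bounds.

Section coefficients.
Variables (R : realType) (N : nat) (Om : set 'rV[R]_N) (ahat : \bar R)
  (beta mu : R -> 'rV[R]_N -> R) (mut a2 : R).
Local Notation leb := (@lebesgue_measure R).
Hypotheses (a20 : 0 < a2) (a2h : (a2%:E < ahat)%E).

Let in_age (a : R) : open_interval 0 a2 a -> 0 < a /\ (a%:E < ahat)%E.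
Proof. by move=> /andP[a0 aa2]; split => //; apply: lt_trans a2h; rewrite lte_fin. Qed.

Lemma mortality_locally_bounded (x0 : 'rV[R]_N) : mu_hyp ahat mu mut ->
  exists C d : R, [/\ 0 <= C, 0 < d & forall y, `|y - x0| < d ->
    {ae leb, forall a, open_interval 0 a2 a -> mu a y <= C}].
Proof.
move=> [_ [mub [muc _]]]; have [M MP] := mub x0 a2 a20 a2h.
have [d [d0 dP]] := muc a2 a20 a2h x0 1 ltr01.
exists (`|M| + 1), d; split => // y yx.
apply: filterS2 MP (dP _ yx) => a + + Ia => /(_ Ia) h1 /(_ Ia) h2.
have := ler_norm (mu a y - mu a x0); have := ler_norm (mu a x0).
by have := ler_norm M; lra.
Qed.

Hypothesis bH : beta_hyp ahat beta.

Lemma birth_measurable y : measurable_fun (open_interval 0 a2) (beta^~ y).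
Proof.
have [mb _] := bH; apply: measurable_funS (mb y); last by move=> a /in_age.
have [->|h] := eqVneq ahat +oo%E.
  have -> : [set a : R | 0 < a /\ (a%:E < +oo)%E] = `]0, +oo[%classic.
    apply/seteqP; split => a /=; rewrite in_itv /= andbT; first by case.
    by move=> a0; rewrite ltry.
  exact: measurable_itv.
move: a2h h; case: ahat => [r| |] //= _ _.
have -> : [set a : R | 0 < a /\ (a%:E < r%:E)%E] = `]0, r[%classic.
  apply/seteqP; split => a /=; rewrite in_itv /= lte_fin; first by case=> -> ->.
  by case/andP.
exact: measurable_itv.
Qed.

Lemma birth_bounded y : exists2 M : R, 0 <= M &
  {ae leb, forall a, open_interval 0 a2 a -> 0 <= beta a y <= M}.
Proof.
have [_ [bb [b0 _]]] := bH; have [M MP] := bb y.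
exists `|M| => //; apply: filterS2 MP (b0 y) => a h1 h2 Ia.
rewrite (h2 (in_age Ia)) /= (le_trans (ler_norm _))// (le_trans (h1 (in_age Ia)))//.
exact: ler_norm.
Qed.

Lemma leb_age : (leb (open_interval 0 a2) < +oo)%E.
Proof.
rewrite open_intervalE lebesgue_measure_itv/=.
by case: ifPn => // _; rewrite -EFinB ltry.
Qed.

Lemma birth_integrable y (f : R -> R) : {within `[0, a2]%classic, continuous f} ->
  leb.-integrable (open_interval 0 a2) (EFin \o (fun a => beta a y * f a)).
Proof.
move=> cf; have [M M0 MP] := birth_bounded y.
have [F FP] : exists F : R, forall a, 0 <= a <= a2 -> `|f a| <= F.
  have /compact_bounded[F [_ FP]] := continuous_compact cf (segment_compact (a := 0) (b := a2)).
  exists (`|F| + 1) => a a0; apply: FP; first by rewrite (le_lt_trans (ler_norm _))// ltrDl.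
  by exists a.
apply/integrableP; split.
  apply/measurable_EFinP; apply: measurable_funM; first exact: birth_measurable.
  apply: (@measurable_funS _ _ _ _ `[0, a2]%classic) => //.
    by move=> a /andP[a0 aa2] /=; rewrite in_itv /= !ltW.
  exact: subspace_continuous_measurable_fun.
apply: (@le_lt_trans _ _ (\int[leb]_(a in open_interval 0 a2) (M * F)%:E)%E).
  apply: ae_le_integral; move: MP; apply: filterS => a bM Ia /=; rewrite lee_fin normrM.
  have /andP[b0 b1] := bM Ia; rewrite (ger0_norm b0) ler_pM// FP//.
  by case/andP: Ia => h1 h2; rewrite !ltW.
rewrite (integral_cst _ _ (M * F)%:E); last exact: measurable_open_interval.
have F0 : 0 <= F by apply: le_trans (FP 0 _); rewrite ?lexx ?(ltW a20).
by apply: lte_mul_pinfty => //; [rewrite lee_fin mulr_ge0|exact: leb_age].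
Qed.

Hypothesis blow : forall a, 0 <= a < a2 ->
  (0 < \int[leb]_(l in open_interval a a2) beta_low Om beta l)%E.

(* The integral of [beta_low] is a lower integral ([beta_low] is an uncountable
   infimum, perhaps not measurable); it is still monotone, so it bounds the
   births at every [y] at once. *)
Lemma birth_uniform_mass (a1 : R) : Om !=set0 -> 0 <= a1 < a2 ->
  exists2 b0 : R, 0 < b0 & forall y (f : R -> R) (c : R), closure Om y ->
    {within `[0, a2]%classic, continuous f} -> 0 < c ->
    (forall a, 0 <= a <= a2 -> 0 <= f a) ->
    (forall a, a1 < a < a2 -> c <= f a) ->
    c * b0 <= rint (open_interval 0 a2) (fun a => beta a y * f a).
Proof.
move=> [z Oz] a1P; have := blow a1P.
set I := (\int[leb]_(l in _) _)%E => I0.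
have Ib y : closure Om y -> (I <= \int[leb]_(l in open_interval a1 a2) (beta l y)%:E)%E.
  move=> Oy; apply: ae_le_integral; apply: aeW => l _.
  by apply: ereal_inf_lbound; exists y.
have [a10 a1a2] := andP a1P.
have sub a : open_interval a1 a2 a -> open_interval 0 a2 a.
  by case/andP=> h1 h2; rewrite /open_interval /= h2 (le_lt_trans a10 h1).
have bfin y : (\int[leb]_(l in open_interval a1 a2) (beta l y)%:E)%E \is a fin_num.
  have [M M0 MP] := birth_bounded y.
  apply: (@integral_fin_num_bounded _ _ _ _ _ _ M).
  - exact: measurable_open_interval.
  - apply: le_lt_trans leb_age; apply: le_measure; rewrite ?inE //;
    exact: measurable_open_interval.
  - move: MP; apply: filterS => a bM /sub /bM /andP[b0 b1].
    by rewrite ger0_norm.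
have Ifin : I \is a fin_num.
  rewrite ge0_fin_numE ?ltW//; apply: le_lt_trans (Ib z (subset_closure Oz)) _.
  by rewrite ltey_eq bfin.
exists (fine I); first by rewrite fine_gt0// I0 ltey_eq Ifin.
move=> y f c Oy cf c0 f0 fc.
rewrite -lee_fin EFinM (fineK Ifin) /rint fineK; last first.
  apply: integrable_fin_num; last exact: birth_integrable.
  exact: measurable_open_interval.
apply: (@le_trans _ _ (c%:E * \int[leb]_(l in open_interval a1 a2) (beta l y)%:E)%E).
  by rewrite lee_pmul2l// Ib.
rewrite -(fineK (bfin y)) -EFinM -fine_integralZl// fineK; last first.
  have [M M0 MP] := birth_bounded y.
  apply: (@integral_fin_num_bounded _ _ _ _ _ _ (c * M)).
  - exact: measurable_open_interval.
  - apply: le_lt_trans leb_age; apply: le_measure; rewrite ?inE //;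
    exact: measurable_open_interval.
  - move: MP; apply: filterS => a bM /sub /bM /andP[b0 b1].
    by rewrite ger0_norm ?mulr_ge0 ?(ltW c0)// ler_pM2l.
rewrite integral_mkcond [leRHS]integral_mkcond; apply: ae_le_integral.
have [M M0 MP] := birth_bounded y; move: MP; apply: filterS => a bM _.
rewrite /patch; have [/set_mem ia|_] := boolP (a \in open_interval a1 a2).
  have Ia := sub _ ia; rewrite mem_set// lee_fin mulrC.
  by have /andP[b0 _] := bM Ia; rewrite ler_wpM2l// fc.
case: ifPn => // /set_mem Ia; rewrite lee_fin.
have /andP[b0 _] := bM Ia; rewrite mulr_ge0// f0//.
by case/andP: Ia => h1 h2; rewrite !ltW.
Qed.

End coefficients.

Section maximum_principle.
Variables (R : realType) (N : nat) (Om : set 'rV[R]_N) (ahat : \bar R) (D : R)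
  (J : 'rV[R]_N -> R) (beta mu : R -> 'rV[R]_N -> R) (mut a2 : R).
Local Notation leb := (@lebesgue_measure R).
Hypotheses (Omdom : bounded_domain Om) (D0 : 0 < D) (JH : kernel_hyp J)
  (bH : beta_hyp ahat beta) (mH : mu_hyp ahat mu mut) (a20 : 0 < a2)
  (a2h : (a2%:E < ahat)%E)
  (blow : forall a, 0 <= a < a2 ->
    (0 < \int[leb]_(l in open_interval a a2) beta_low Om beta l)%E).

Let Om0 : Om !=set0. Proof. by case: Omdom => _ [_ []]. Qed.
Let Omo : open Om. Proof. by case: Omdom. Qed.
Let J0 y : 0 <= J y. Proof. by case: JH => _ []. Qed.

Let cOm : compact (closure Om).
Proof. by case: Omdom => _ [_ [_ [M OM]]]; exact: (@compact_closure_bounded _ _ _ M). Qed.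

Let in_closed a : open_interval 0 a2 a -> 0 <= a <= a2.
Proof. by case/andP=> h1 h2; rewrite !ltW. Qed.

Section supersolution.
Variables (u g : R -> 'rV[R]_N -> R).
Hypotheses (uW : W11 Om a2 u g)
  (u_birth : forall x, Om x -> Aop1 a2 beta u x <= 0)
  (u_age : forall x, Om x -> {ae leb, forall a, open_interval 0 a2 a ->
     Aop2 Om J D mu u g a x <= 0}).

Section comparison.
Variables (phi h : R -> 'rV[R]_N -> R) (lam : R).
Hypotheses (lam0 : lam < 0) (phiW : W11 Om a2 phi h)
  (phi0 : forall a x, closed_interval 0 a2 a -> closure Om x -> 0 < phi a x)
  (phi_birth : forall x, closure Om x -> Aop1 a2 beta phi x = 0)
  (phi_age : forall x, closure Om x -> {ae leb, forall a, open_interval 0 a2 a ->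
     Aop2 Om J D mu phi h a x = lam * phi a x}).

Variable m : R.
Let w a x := u a x + m * phi a x.
Hypotheses (m0 : 0 < m)
  (w0 : forall a x, 0 <= a <= a2 -> closure Om x -> 0 <= w a x).

Let w_joint x t (e : R) : closure Om x -> 0 <= t <= a2 -> 0 < e ->
  exists2 d : R, 0 < d & forall s y, 0 <= s <= a2 -> closure Om y ->
    `|s - t| <= d -> `|y - x| < d -> `|w s y - w t x| <= e.
Proof.
move=> Ox t0 e0; have e20 : 0 < e / 2 by rewrite divr_gt0.
have e2m : 0 < e / 2 / m by rewrite divr_gt0.
have [d1 d10 d1P] := W11_continuous_joint uW Ox t0 e20.
have [d2 d20 d2P] := W11_continuous_joint phiW Ox t0 e2m.
exists (Num.min d1 d2); first by rewrite lt_min d10.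
move=> s y s0 Oy; rewrite le_min lt_min => /andP[s1 s2] /andP[y1 y2].
rewrite /w (_ : _ - _ = (u s y - u t x) + m * (phi s y - phi t x)); last by ring.
apply: le_trans (ler_normD _ _) _; rewrite normrM (gtr0_norm m0).
have := d1P _ _ s0 Oy s1 y1; have := d2P _ _ s0 Oy s2 y2.
by rewrite ler_pdivlMr// mulrC; lra.
Qed.

Let w_unif x (e : R) : closure Om x -> 0 < e ->
  exists2 d : R, 0 < d & forall a y, 0 <= a <= a2 -> closure Om y ->
    `|y - x| < d -> `|w a y - w a x| <= e.
Proof.
move=> Ox e0; have e20 : 0 < e / 2 by rewrite divr_gt0.
have e2m : 0 < e / 2 / m by rewrite divr_gt0.
have [d1 d10 d1P] := W11_continuous_unif uW Ox e20.
have [d2 d20 d2P] := W11_continuous_unif phiW Ox e2m.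
exists (Num.min d1 d2); first by rewrite lt_min d10.
move=> s y s0 Oy; rewrite lt_min => /andP[y1 y2].
rewrite /w (_ : _ - _ = (u s y - u s x) + m * (phi s y - phi s x)); last by ring.
apply: le_trans (ler_normD _ _) _; rewrite normrM (gtr0_norm m0).
have := d1P _ _ s0 Oy y1; have := d2P _ _ s0 Oy y2.
by rewrite ler_pdivlMr// mulrC; lra.
Qed.

Let w_time x : closure Om x -> {within `[0, a2]%classic, continuous (w^~ x)}.
Proof.
move=> Ox; apply/(@within_continuous_dist R R^o R^o) => a /=.
rewrite in_itv /= => aP e e0; have [d d0 dP] := w_joint Ox aP e0.
exists d => // b; rewrite /= in_itv /= => bP /ltW ba.
by apply: dP => //; rewrite subrr normr0.
Qed.

Let Kw_ge0 a y : 0 <= a <= a2 ->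
  0 <= Kop J Om (u a) y + m * Kop J Om (phi a) y.
Proof.
move=> a0.
have [_ [_ [_ [B OB]]]] := Omdom; have [cJ [_ [[r [r0 Jr]] _]]] := JH.
have [MJ MJ0 JM] := compact_support_bounded cJ Jr.
have [M1 M10 M1P] := W11_bounded (ltW a20) cOm Om0 uW.
have [M2 M20 M2P] := W11_bounded (ltW a20) cOm Om0 phiW.
rewrite -KopZ// -[X in _ + X]opprK -KopN subr_ge0.
apply: (@le_Kop _ _ _ _ B MJ OB JM _ _ _ (M1 + m * M2)) => // z Oz.
- rewrite normrN normrM (gtr0_norm m0).
  apply: (@le_trans _ _ (m * M2)); last by rewrite lerDr.
  by rewrite ler_pM2l// M2P//; exact: subset_closure.
- apply: (@le_trans _ _ M1); last by rewrite lerDl mulr_ge0// ltW.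
  by rewrite M1P//; exact: subset_closure.
- have := w0 a0 (subset_closure Oz); rewrite /w; lra.
Qed.

Let w_age y (C : R) : Om y ->
  {ae leb, forall a, open_interval 0 a2 a -> mu a y <= C} ->
  {ae leb, forall a, open_interval 0 a2 a ->
    - ((D + C) * w a y) + m * - lam * phi a y <= g a y + m * h a y}.
Proof.
move=> Oy muC; move: (u_age Oy) (phi_age (subset_closure Oy)) muC.
apply: filterS3 => a + + + Ia => /(_ Ia) h1 /(_ Ia) h2 /(_ Ia) h3.
have aP := in_closed Ia; have Kw := Kw_ge0 y aP.
have := w0 aP (subset_closure Oy); move: h1 h2; rewrite /Aop2 /w.
set p := phi a y; set v := u a y; set K1 := Kop _ _ (u a) _ in Kw *.
set K2 := Kop _ _ (phi a) _ in Kw *; set gu := g a y; set gh := h a y.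
move=> h1 h2 wp.
have ghE : gh = D * (K2 - p) - mu a y * p - lam * p by rewrite -h2; ring.
have h4 : mu a y * (v + m * p) <= C * (v + m * p) by rewrite ler_wpM2r.
have h5 : 0 <= D * (K1 + m * K2) by rewrite mulr_ge0// ltW.
have h1' : D * (K1 - v) - mu a y * v <= gu by lra.
rewrite ghE; nra.
Qed.

Let w_pos_age t x : closure Om x -> 0 < t <= a2 -> 0 < w t x.
Proof.
move=> Ox /andP[t0 ta2]; have tP : 0 <= t <= a2 by rewrite (ltW t0).
rewrite lt_neqAle w0// andbT eq_sym; apply/negP => /eqP wtx.
have [C [d1 [C0 d10 d1P]]] := mortality_locally_bounded a20 a2h x mH.
have p0 : 0 < phi t x by apply: phi0.
pose kap := m * - lam * phi t x / 4.
have kap0 : 0 < kap by rewrite divr_gt0// !mulr_gt0// oppr_gt0.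
have DC0 : 0 < D + C by rewrite ltr_wpDr.
have e0 : 0 < kap / (D + C) by rewrite divr_gt0.
have p20 : 0 < phi t x / 2 by rewrite divr_gt0.
have [d2 d20 d2P] := w_joint Ox tP e0.
have [d3 d30 d3P] := W11_continuous_joint phiW Ox tP p20.
pose eta := Num.min t (Num.min d2 d3).
have eta0 : 0 < eta by rewrite !lt_min t0 d20.
have [eta1 eta2 eta3] : [/\ eta <= t, eta <= d2 & eta <= d3].
  by split; rewrite /eta !ge_min lexx ?orbT.
have ke0 : 0 < kap * eta / 2 by rewrite divr_gt0// mulr_gt0.
have [d4 d40 d4P] := w_joint Ox tP ke0.
have d0 : 0 < Num.min (Num.min d1 d2) (Num.min d3 d4) by rewrite !lt_min d10 d20 d30.
have [y Oy] := closure_dist Ox d0.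
rewrite !lt_min => /andP[/andP[yd1 yd2] /andP[yd3 yd4]].
have cy := subset_closure Oy.
have te0 : 0 <= t - eta by rewrite subr_ge0.
have tet : t - eta <= t by rewrite gerBl ltW.
have gr : kap * (t - (t - eta)) <= w t y - w (t - eta) y.
  apply: (W11_growth2 uW phiW cy te0 tet ta2).
  move: (w_age Oy (d1P _ yd1)); apply: filterS => s + Is /andP[s1 s2].
  move=> /(_ Is); apply: le_trans.
  have sP := in_closed Is.
  have st : `|s - t| <= eta by rewrite ler_norml; apply/andP; split; lra.
  have hw := d2P _ _ sP cy (le_trans st eta2) yd2.
  have hp := d3P _ _ sP cy (le_trans st eta3) yd3.
  rewrite wtx subr0 in hw; have {}hw := le_trans (ler_norm _) hw.
  rewrite ler_pdivlMr// mulrC in hw.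
  have {}hp : phi t x / 2 <= phi s y.
    by move: hp; rewrite ler_norml => /andP[]; lra.
  have : m * - lam * (phi t x / 2) <= m * - lam * phi s y.
    by rewrite ler_pM2l// mulr_gt0// oppr_gt0.
  by rewrite /kap in hw *; lra.
have wte : 0 <= w (t - eta) y by rewrite w0// te0 (le_trans tet).
have : `|w t y - w t x| <= kap * eta / 2.
  by apply: d4P => //; rewrite subrr normr0 ltW.
rewrite wtx subr0 => /(le_trans (ler_norm _)).
have : 0 < kap * eta by rewrite mulr_gt0.
rewrite (_ : t - (t - eta) = eta) in gr; last by ring.
lra.
Qed.

Let w_birth y : Om y ->
  rint (open_interval 0 a2) (fun a => beta a y * w a y) <= w 0 y.
Proof.
move=> Oy; have cy := subset_closure Oy.
have := u_birth Oy; have := phi_birth cy; rewrite /Aop1 /w => h1 h2.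
have i1 := birth_integrable a20 a2h bH y (W11_continuous_time uW cy).
have i2 := birth_integrable a20 a2h bH y (W11_continuous_time phiW cy).
have mI := measurable_open_interval 0 a2.
have i3 : leb.-integrable (open_interval 0 a2)
    (EFin \o (fun a => m * (beta a y * phi a y))).
  by apply: (fun hI => integrableZl hI m i2); exact: measurable_open_interval.
have -> : rint (open_interval 0 a2) (fun a => beta a y * (u a y + m * phi a y)) =
    rint (open_interval 0 a2) (fun a => beta a y * u a y) +
    m * rint (open_interval 0 a2) (fun a => beta a y * phi a y).
  transitivity (Rintegral leb (open_interval 0 a2)
      (fun a => beta a y * u a y + m * (beta a y * phi a y))).
    by congr fine; apply: eq_integral => a _; congr EFin; ring.
  by rewrite RintegralD// RintegralZl.
have -> : phi 0 y = rint (open_interval 0 a2) (fun a => beta a y * phi a y) by lra.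
lra.
Qed.

Let w_pos_birth x : closure Om x -> 0 < w 0 x.
Proof.
move=> Ox; have P0 : (0 : R) <= 0 <= a2 by apply/andP; split => //; exact: ltW.
rewrite lt_neqAle w0// andbT eq_sym; apply/negP => /eqP w0x.
pose a1 := a2 / 2; have a1P : 0 <= a1 < a2 by rewrite /a1; apply/andP; split; move: a20; lra.
have [a10 a12] := andP a1P.
have cw1 : {within `[a1, a2]%classic, continuous (w^~ x)}.
  apply: continuous_subspaceW (w_time Ox) => a /=; rewrite !in_itv /= => /andP[h1 ->].
  by rewrite (le_trans a10 h1).
have [t tP tmin] := EVT_min (ltW a12) cw1.
have [t1 t2] : a1 <= t /\ t <= a2 by move: tP; rewrite in_itv /= => /andP.
have c0 : 0 < w t x / 2.
  by rewrite divr_gt0// w_pos_age// t2 andbT (lt_le_trans _ t1)// /a1 divr_gt0.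
have [b0 b00 b0P] := birth_uniform_mass a20 a2h bH blow Om0 a1P.
have [d1 d10 d1P] := w_unif Ox c0.
have e0 : 0 < w t x / 2 * b0 / 2 by rewrite divr_gt0// mulr_gt0.
have [d2 d20 d2P] := w_unif Ox e0.
have d0 : 0 < Num.min d1 d2 by rewrite lt_min d10.
have [y Oy] := closure_dist Ox d0; rewrite lt_min => /andP[yd1 yd2].
have cy := subset_closure Oy.
have : w t x / 2 * b0 <= w 0 y.
  apply: le_trans (w_birth Oy); apply: b0P => //; first exact: w_time.
    by move=> a aP; apply: w0.
  move=> a /andP[h1 h2]; have aP : 0 <= a <= a2 by rewrite (le_trans a10) ltW.
  have := d1P _ _ aP cy yd1; rewrite ler_norml => /andP[+ _].
  have : w t x <= w a x by apply: tmin; rewrite in_itv /= !ltW.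
  lra.
have := d2P _ _ P0 cy yd2; rewrite w0x subr0 => /(le_trans (ler_norm _)).
have : 0 < w t x / 2 * b0 by rewrite mulr_gt0.
lra.
Qed.

Lemma comparison_pos a x : 0 <= a <= a2 -> closure Om x -> 0 < u a x + m * phi a x.
Proof.
move=> /andP[]; rewrite le_eqVlt => /predU1P[<- _|a0 aa2] Ox; first exact: w_pos_birth.
by apply: w_pos_age => //; rewrite a0.
Qed.

End comparison.

Lemma supersolution_ge0 (phi h : R -> 'rV[R]_N -> R) (lam : R) : lam < 0 ->
  W11 Om a2 phi h ->
  (forall a x, closed_interval 0 a2 a -> closure Om x -> 0 < phi a x) ->
  (forall x, closure Om x -> Aop1 a2 beta phi x = 0) ->
  (forall x, closure Om x -> {ae leb, forall a, open_interval 0 a2 a ->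
     Aop2 Om J D mu phi h a x = lam * phi a x}) ->
  forall a x, 0 <= a <= a2 -> closure Om x -> 0 <= u a x.
Proof.
move=> lam0 phiW phi0 phi_birth phi_age b z bP Oz.
have KP (p : R * 'rV[R]_N) : (`[0, a2]%classic `*` closure Om) p ->
    0 <= p.1 <= a2 /\ closure Om p.2.
  by case=> /= h1 h2; move: h1; rewrite in_itv.
have cq : {within `[0, a2]%classic `*` closure Om,
    continuous (fun p => u p.1 p.2 / phi p.1 p.2)}.
  have /subspace_continuousP cu := W11_continuous_prod uW.
  have /subspace_continuousP cp := W11_continuous_prod phiW.
  apply/subspace_continuousP => p Kp; apply: cvgM; first exact: cu.
  apply: cvgV; last exact: cp.
  by have [h1 h2] := KP _ Kp; rewrite gt_eqF// phi0.
have K0 : (`[0, a2]%classic `*` closure Om) (b, z) by split => //=; rewrite in_itv.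
have cK : compact (`[0, a2]%classic `*` closure Om).
  by apply: compact_setX => //; exact: segment_compact.
have [p /set_mem pK pmin] := compact_EVT_min (ex_intro _ _ K0) cK cq.
have [pP1 pP2] := KP _ pK; have php := phi0 _ _ pP1 pP2.
rewrite leNgt; apply/negP => ubz.
have qz : u p.1 p.2 / phi p.1 p.2 <= u b z / phi b z by apply: (pmin (b, z)); rewrite inE.
have phz := phi0 _ _ bP Oz.
pose m := - (u p.1 p.2 / phi p.1 p.2).
have m0 : 0 < m.
  by rewrite oppr_gt0 (le_lt_trans qz)// pmulr_llt0// invr_gt0.
have w0 a x : 0 <= a <= a2 -> closure Om x -> 0 <= u a x + m * phi a x.
  move=> aP Ox; have pax := phi0 _ _ aP Ox.
  have : u p.1 p.2 / phi p.1 p.2 <= u a x / phi a x.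
    by apply: (pmin (a, x)); rewrite inE; split => //=; rewrite in_itv.
  by rewrite ler_pdivlMr// /m mulNr subr_ge0.
have := comparison_pos lam0 phiW phi0 phi_birth phi_age m0 w0 pP1 pP2.
by rewrite /m mulNr divfK ?gt_eqF// subrr ltxx.
Qed.

Hypothesis u0 : forall a x, 0 <= a <= a2 -> closure Om x -> 0 <= u a x.

Let u_persist x a b : Om x -> 0 <= a -> a <= b -> b <= a2 -> 0 < u a x -> 0 < u b x.
Proof.
move=> Ox; have cx := subset_closure Ox.
have [C [d [C0 d0 dP]]] := mortality_locally_bounded a20 a2h x mH.
have muC := dP x; rewrite subrr normr0 in muC; move/(_ d0) in muC.
have DC0 : 0 < D + C by rewrite ltr_wpDr.
pose st := (2 * (D + C))^-1; have st0 : 0 < st by rewrite invr_gt0 mulr_gt0.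
have short a' b' : 0 <= a' -> a' <= b' -> b' <= a2 -> b' - a' <= st -> 0 < u a' x ->
    0 < u b' x.
  move=> a0 ab ba2 abst ua.
  have cu : {within `[a', b']%classic, continuous (u^~ x)}.
    apply: continuous_subspaceW (W11_continuous_time uW cx) => s /=.
    by rewrite !in_itv /= => /andP[h1 h2]; rewrite (le_trans a0 h1) (le_trans h2).
  have [t + tmax] := EVT_max ab cu; rewrite in_itv /= => /andP[t1 t2].
  have M0 : 0 < u t x.
    by apply: lt_le_trans ua _; apply: tmax; rewrite in_itv /= lexx.
  have gr : - ((D + C) * u t x) * (b' - t) <= u b' x - u t x.
    apply: (W11_growth uW cx (le_trans a0 t1) t2 ba2).
    move: (u_age Ox) muC; apply: filterS2 => s + + Is /andP[s1 s2].
    move=> /(_ Is) h1 /(_ Is) h2; have sP := in_closed Is.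
    have us := u0 sP cx.
    have K0 : 0 <= Kop J Om (u s) x.
      by apply: Kop_ge0 => // y Oy; apply: u0 => //; exact: subset_closure.
    have ust : u s x <= u t x.
      by apply: tmax; rewrite in_itv /= s2 (le_trans t1)// ltW.
    have h3 : mu s x * u s x <= C * u s x by rewrite ler_wpM2r.
    have h4 : (D + C) * u s x <= (D + C) * u t x by rewrite ler_pM2l.
    have h5 : 0 <= D * Kop J Om (u s) x by rewrite mulr_ge0// ltW.
    move: h1; rewrite /Aop2; lra.
  have h1 : (D + C) * u t x * (b' - t) <= (D + C) * u t x * st.
    by rewrite ler_pM2l ?mulr_gt0//; lra.
  have h2 : (D + C) * u t x * st = u t x / 2.
    rewrite /st; field; lra.
  lra.
have chain (n : nat) : forall a b, 0 <= a -> a <= b -> b <= a2 ->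
    b - a <= n%:R * st -> 0 < u a x -> 0 < u b x.
  elim: n => [|n IH] a' b' a0 ab ba2.
    by rewrite mul0r => h; have -> : b' = a' by lra.
  rewrite -natr1 mulrDl mul1r => h ua.
  have [bst|bst] := leP (b' - a') st; first exact: short ua.
  apply: (@IH (a' + st)) => //; try lra.
  by apply: short ua => //; lra.
move=> a0 ab ba2; apply: (chain (Num.truncn ((b - a) / st)).+1) => //.
by rewrite -ler_pdivrMr// ltW// truncnS_gt.
Qed.

Let u_spread (as_ : R) : 0 <= as_ < a2 ->
  exists2 d : R, 0 < d & forall x y, Om x -> Om y -> `|y - x| < d ->
    (forall a, as_ < a <= a2 -> 0 < u a x) -> forall a, as_ < a <= a2 -> 0 < u a y.
Proof.
move=> /andP[as0 as2].
have [_ [_ [_ [B OB]]]] := Omdom; have [cJ [_ [[r [r0 Jr]] [J00 _]]]] := JH.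
have [MJ MJ0 JM] := compact_support_bounded cJ Jr.
have [M1 M10 M1P] := W11_bounded (ltW a20) cOm Om0 uW.
have [d d0 dP] : exists2 d : R, 0 < d & forall z, `|z| < d -> J 0 / 2 <= J z.
  have cJ0 : {for 0, continuous J} by exact: cJ.
  have J20 : 0 < J 0 / 2 by rewrite divr_gt0.
  move/cvgrPdist_le : cJ0 => /(_ _ J20)/nbhs_normP[d /= d0 dP].
  exists d => // z zd; have := dP z; rewrite /= sub0r normrN => /(_ zd).
  by rewrite ler_norml => /andP[_]; lra.
exists d => // x y Ox Oy yx ux a /andP[a0 aa2].
have cx := subset_closure Ox; have cy := subset_closure Oy.
have a_ge0 : 0 <= a by rewrite (le_trans as0)// ltW.
rewrite lt_neqAle u0 ?a_ge0// andbT eq_sym; apply/negP => /eqP uay.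
have uz s : 0 <= s <= a -> u s y = 0.
  move=> /andP[s0 sa]; apply/le_anti; rewrite u0 ?s0 ?(le_trans sa)// andbT leNgt.
  by apply/negP => /(u_persist Oy s0 sa aa2); rewrite uay ltxx.
pose a1 := (as_ + a) / 2.
have [a11 a12 a10] : [/\ as_ < a1, a1 < a & 0 <= a1] by rewrite /a1; split; lra.
have cu : {within `[a1, a2]%classic, continuous (u^~ x)}.
  apply: continuous_subspaceW (W11_continuous_time uW cx) => s /=.
  by rewrite !in_itv /= => /andP[h1 ->]; rewrite (le_trans a10 h1).
have a1a2 : a1 <= a2 by rewrite (le_trans (ltW a12)).
have [t + tmin] := EVT_min a1a2 cu; rewrite in_itv /= => /andP[t1 t2].
have c0 : 0 < u t x / 2 by rewrite divr_gt0// ux// t2 andbT (lt_le_trans a11).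
have [d1 d10 d1P] := W11_continuous_unif uW cx c0.
have [d2 d20 d2P] : exists2 d : R, 0 < d & forall z, `|z - x| < d -> Om z.
  have /nbhs_normP[d2 /= d20 d2P] := open_nbhs_nbhs (conj Omo Ox).
  by exists d2 => // z zx; apply: d2P; rewrite /= distrC.
pose rho := Num.min (Num.min (d1 / 2) (d2 / 2)) ((d - `|y - x|) / 2).
have rho0 : 0 < rho by rewrite !lt_min !divr_gt0// subr_gt0.
have [rh1 rh2 rh3] : [/\ rho <= d1 / 2, rho <= d2 / 2 & rho <= (d - `|y - x|) / 2].
  by split; rewrite /rho !ge_min lexx ?orbT.
pose kap := D * (J 0 / 2 * (u t x / 2) * (2 * rho) ^+ N).
have kap0 : 0 < kap.
  apply: mulr_gt0 => //; apply: mulr_gt0; last by apply: exprn_gt0; exact: mulr_gt0.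
  by apply: mulr_gt0 => //; exact: divr_gt0.
have : kap * (a - a1) <= u a y - u a1 y.
  apply: (W11_growth uW cy a10 (ltW a12) aa2).
  move: (u_age Oy); apply: filterS => s + Is /andP[s1 s2] => /(_ Is).
  have sP := in_closed Is; rewrite /Aop2.
  have -> : u s y = 0 by apply: uz; rewrite s2 andbT; case/andP: sP.
  have : J 0 / 2 * (u t x / 2) * (2 * rho) ^+ N <= Kop J Om (u s) y.
    apply: (@Kop_lower _ _ _ _ B MJ OB JM _ _ M1 x) => //; try lra.
    - move=> z Oz; have cz := subset_closure Oz; rewrite u0//=.
      by rewrite (le_trans (ler_norm _))// M1P.
    - move=> z zx; have Oz : Om z by apply: d2P; lra.
      split => //.
        apply: dP; have -> : y - z = (y - x) - (z - x) by rewrite opprB addrA subrK.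
        by apply: le_lt_trans (ler_normB _ _) _; lra.
      have : u t x <= u s x.
        by apply: tmin; rewrite in_itv /= (ltW s1) (le_trans s2).
      have zd1 : `|z - x| < d1 by lra.
      have := d1P _ _ sP (subset_closure Oz) zd1.
      by rewrite ler_norml => /andP[+ _]; lra.
  by rewrite -(ler_pM2l D0) -/kap; lra.
have ua1 : u a1 y = 0 by apply: uz; rewrite a10 ltW.
by rewrite uay ua1 subrr leNgt mulr_gt0// subr_gt0.
Qed.

Lemma supersolution_dichotomy :
  (forall a x, closed_interval 0 a2 a -> Om x -> u a x = 0) \/
  (forall a x, closed_interval 0 a2 a -> Om x -> 0 < u a x).
Proof.
have [|nz] := pselect (exists a x, [/\ 0 <= a <= a2, Om x & u a x != 0]); last first.
  left=> a x aP Ox; apply: contrapT => ux; apply: nz; exists a, x; split => //.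
  exact/eqP.
move=> [ap [xp [apP Oxp uap]]]; right.
have cxp := subset_closure Oxp.
have {}uap : 0 < u ap xp by rewrite lt_neqAle eq_sym uap u0.
have [as_ asP uas] : exists2 as_, 0 <= as_ < a2 & forall a, as_ < a <= a2 -> 0 < u a xp.
  have [ap0 apa2] := andP apP.
  have [ap2|ap2] := ltP ap a2.
    exists ap; first by rewrite ap0.
    by move=> a /andP[/ltW h1 h2]; apply: u_persist uap.
  have apE : ap = a2 by apply/le_anti; rewrite apa2.
  have e0 : 0 < u ap xp / 2 by rewrite divr_gt0.
  have [d d0 dP] := W11_equicontinuous_dist uW e0.
  pose s := Num.max 0 (a2 - d).
  have s0 : 0 <= s by rewrite le_max lexx.
  have s2 : s < a2 by rewrite gt_max a20; lra.
  have sd : a2 - d <= s by rewrite le_max lexx orbT.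
  exists s; first by rewrite s0.
  move=> a /andP[sa aa2]; have aP : 0 <= a <= a2 by rewrite aa2 (le_trans s0 (ltW sa)).
  have ad : `|a - ap| <= d by rewrite apE ler0_norm ?subr_le0//; lra.
  by have := dP _ _ _ cxp apP aP ad; rewrite ler_norml => /andP[]; lra.
have [d d0 dP] := u_spread asP.
pose P := [set x | Om x /\ forall a, as_ < a <= a2 -> 0 < u a x].
have PE : P = Om.
  have [_ [cO _]] := Omdom; apply: cO; first by exists xp.
  - exists (\bigcup_(x in P) [set y | `|y - x| < d]).
      apply: bigcup_open => x _; rewrite openE => y /= yx.
      have h : 0 < d - `|y - x| by rewrite subr_gt0.
      apply: filterS (nbhs_dist_lt y h) => z /= zy.
      have -> : z - x = (z - y) + (y - x) by rewrite addrA subrK.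
      by apply: le_lt_trans (ler_normD _ _) _; lra.
    apply/seteqP; split => y.
      by move=> [Oy uy]; split => //; exists y => //=; rewrite subrr normr0.
    by move=> [Oy [x [Ox ux] /= yx]]; split => //; exact: dP ux.
  - exists (~` (\bigcup_(x in Om `\` P) [set y | `|y - x| < d])).
      apply: open_closedC.
      apply: bigcup_open => x _; rewrite openE => y /= yx.
      have h : 0 < d - `|y - x| by rewrite subr_gt0.
      apply: filterS (nbhs_dist_lt y h) => z /= zy.
      have -> : z - x = (z - y) + (y - x) by rewrite addrA subrK.
      by apply: le_lt_trans (ler_normD _ _) _; lra.
    apply/seteqP; split => y.
      move=> [Oy uy]; split => // -[x [Ox nPx] /= yx]; apply: nPx.
      by split => //; apply: dP uy; rewrite // distrC.
    move=> [Oy nb]; apply: contrapT => nPy; apply: nb; exists y => //=.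
    by rewrite subrr normr0.
move=> a x aP Ox; have cx := subset_closure Ox.
have [_ ux] : P x by rewrite PE.
have [as0 as2] := andP asP.
suff u0x : 0 < u 0 x by case/andP: aP => h1 h2; exact: u_persist u0x.
pose a1 := (as_ + a2) / 2.
have [a11 a12 a10] : [/\ as_ < a1, a1 < a2 & 0 <= a1] by rewrite /a1; split; lra.
have cu := W11_continuous_time uW cx.
have cu1 : {within `[a1, a2]%classic, continuous (u^~ x)}.
  apply: continuous_subspaceW cu => s /=.
  by rewrite !in_itv /= => /andP[h1 ->]; rewrite (le_trans a10 h1).
have [t + tmin] := EVT_min (ltW a12) cu1; rewrite in_itv /= => /andP[t1 t2].
have c0 : 0 < u t x by rewrite ux// t2 andbT (lt_le_trans a11).
have a1P : 0 <= a1 < a2 by rewrite a10.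
have [b0 b00 b0P] := birth_uniform_mass a20 a2h bH blow Om0 a1P.
have : u t x * b0 <= rint (open_interval 0 a2) (fun a => beta a x * u a x).
  apply: b0P => // [s sP|s /andP[s1 s2]]; first exact: u0.
  by apply: tmin; rewrite in_itv /= !ltW.
have := mulr_gt0 c0 b00; have := u_birth Ox; rewrite /Aop1; lra.
Qed.

End supersolution.
End maximum_principle.

Theorem mainTheorem19 (R : realType) (N : nat) (Om : set 'rV[R]_N)
  (ahat : \bar R) (D : R) (J : 'rV[R]_N -> R)
  (beta mu : R -> 'rV[R]_N -> R) (mut : R) (a2 : R)
  (lam1 : R) (phi : R -> 'rV[R]_N -> R) :
  (1 <= N)%N ->
  bounded_domain Om ->
  (0 < ahat)%E -> 0 < D ->
  kernel_hyp J ->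
  beta_hyp ahat beta ->
  mu_hyp ahat mu mut ->
  0 < a2 -> (a2%:E < ahat)%E ->
  (forall x, closure Om x ->
     {ae (@lebesgue_measure R), forall a, a2 <= a -> (a%:E < ahat)%E ->
        beta a x = 0}) ->
  (forall a, 0 <= a < a2 ->
     (0 < \int[(@lebesgue_measure R)]_(l in open_interval a a2)
            beta_low Om beta l)%E) ->
  principal_eigenpair Om J D a2 beta mu lam1 phi ->
  (strong_max_principle Om J D a2 beta mu <-> lam1 < 0).
Proof.
move=> _ Omdom _ D0 JH bH mH a20 a2h _ blow [[h [phiW [_ [phi_birth phi_age]]]] [phi0 _]].
split=> [smp|lam0 u g uW u_birth u_age]; last first.
  apply: (supersolution_dichotomy Omdom D0 JH bH mH a20 a2h blow uW u_birth u_age).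
  exact: (supersolution_ge0 Omdom D0 JH bH mH a20 a2h blow uW u_birth u_age
    lam0 phiW phi0 phi_birth phi_age).
rewrite ltNge; apply/negP => lam0.
have [_ [_ [[x Ox] _]]] := Omdom; have cx := subset_closure Ox.
have P0 : closed_interval 0 a2 0 by apply/andP; split => //; exact: ltW.
have phi0x := phi0 _ _ P0 cx.
case: (smp _ _ (W11N phiW)) => [y Oy|y Oy|H|H].
- have -> : Aop1 a2 beta (fun a z => - phi a z) y = - Aop1 a2 beta phi y.
    rewrite /Aop1 opprD /rint -fine_integralN; congr (_ + fine _).
    by apply: eq_integral => a _; rewrite mulrN.
  by rewrite phi_birth ?oppr0//; exact: subset_closure.
- move: (phi_age _ (subset_closure Oy)); apply: filterS => a + Ia => /(_ Ia) E.
  have -> : Aop2 Om J D mu (fun a z => - phi a z) (fun a z => - h a z) a y =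
      - Aop2 Om J D mu phi h a y.
    by rewrite /Aop2 KopN; ring.
  rewrite E oppr_le0 mulr_ge0// ltW// phi0//; last exact: subset_closure.
  by case/andP: Ia => h1 h2; rewrite /closed_interval /= !ltW.
- by have := H _ _ P0 Ox; move: phi0x; lra.
- by have := H _ _ P0 Ox; move: phi0x; lra.
Qed.
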